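(* The variety $\mathcal{V}$ of all double-Heyting algebras is not coherent, does not admit right uniform deductive interpolation, and its first-order theory does not have a model completion.
   Context: A double-Heyting algebra is an algebra $\langle A,\wedge,\vee,\to,-,0,1\rangle$ such that $\langle A,\wedge,\vee,\to,0,1\rangle$ is a Heyting algebra and $\langle A,\vee,\wedge,-,0,1\rangle$ is a dual Heyting algebra, with $-$ dually residuating $\vee$: $x-y\le z\iff x\le y\vee z$. A variety $\mathcal{V}$ is coherent if every finitely generated subalgebra of a finitely presented member of $\mathcal{V}$ is finitely presented (finitely presented: isomorphic to a quotient of a finitely generated free algebra of $\mathcal{V}$ by a finitely generated congruence). $\Sigma\models_{\mathcal{V}}\varepsilon$ means that every assignment of the variables into any member of $\mathcal{V}$ satisfying all equations in $\Sigma$ satisfies $\varepsilon$. $\mathcal{V}$ admits right uniform deductive interpolation if for any finite disjoint sets of variables $\overline{x},\overline{y}$ and finite set $\Sigma$ of equations in variables $\overline{x},\overline{y}$, there is a finite set $\Pi$ of equations in variables $\overline{y}$ such that for every equation $\varepsilon$ whose variables lie in $\overline{y}$ and a set $\overline{z}$ disjoint from $\overline{x},\overline{y}$: $\Sigma\models_{\mathcal{V}}\varepsilon\iff\Pi\models_{\mathcal{V}}\varepsilon$. A model completion of a theory $T$ is a theory $T^*\supseteq T$ in the same language such that every model of $T$ embeds into a model of $T^*$ and, for every model $M$ of $T$, $T^*$ together with the quantifier-free diagram of $M$ is a complete theory. *)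

(* Defs.v *)
From Stdlib Require List.
From mathcomp Require Import all_boot.
From mathcomp Require Import boolp.

Set Implicit Arguments.
Unset Strict Implicit.
Unset Printing Implicit Defensive.

Record signature : Type := Signature {
  op : Type;
  arity : op -> nat
}.

Record algebra (S : signature) : Type := Algebra {
  carrier :> Type;
  interp : forall f : op S, ('I_(arity f) -> carrier) -> carrier
}.

Section Algebras.
Variable S : signature.
Implicit Types A B F : algebra S.

Definition homomorphism A B (h : A -> B) : Prop :=
  forall (f : op S) (a : 'I_(arity f) -> A),
    h (interp a) = interp (fun i => h (a i)).

(* The language has no relation symbols besides equality, so embeddings are
   exactly the injective homomorphisms. *)
Definition embedding A B (h : A -> B) : Prop :=
  homomorphism h /\ injective h.

Definition isomorphic A B : Prop :=
  exists h : A -> B, homomorphism h /\ bijective h.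

Definition subuniverse A (P : A -> Prop) : Prop :=
  forall (f : op S) (a : 'I_(arity f) -> A), (forall i, P (a i)) -> P (interp a).

Definition generated A (X : A -> Prop) (a : A) : Prop :=
  forall P : A -> Prop, subuniverse P -> (forall x, X x -> P x) -> P a.

Lemma generated_subuniverse A (X : A -> Prop) : subuniverse (generated X).
Proof. by move=> f a ha P hP hX; apply: (hP) => i; apply: ha. Qed.

Definition generated_subalgebra A (X : A -> Prop) : algebra S :=
  @Algebra S {a : A | generated X a}
    (fun f a => exist _ (interp (fun i => sval (a i)))
                  (generated_subuniverse (fun i => svalP (a i)))).

Record congruence A (theta : A -> A -> Prop) : Prop := Congruence {
  cong_refl : forall a, theta a a;
  cong_sym : forall a b, theta a b -> theta b a;
  cong_trans : forall a b c, theta a b -> theta b c -> theta a c;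
  cong_interp : forall (f : op S) (a b : 'I_(arity f) -> A),
    (forall i, theta (a i) (b i)) -> theta (interp a) (interp b)
}.

Definition generated_congruence A (R : A -> A -> Prop) (a b : A) : Prop :=
  forall theta : A -> A -> Prop,
    congruence theta -> (forall x y, R x y -> theta x y) -> theta a b.

Definition eq_class A (theta : A -> A -> Prop) : Type :=
  {C : A -> Prop | exists a, C = theta a}.

Definition class_of A (theta : A -> A -> Prop) (a : A) : eq_class theta :=
  exist _ (theta a) (ex_intro _ a erefl).

Definition repr A (theta : A -> A -> Prop) (C : eq_class theta) : A :=
  sval (cid (svalP C)).

(* The operations act on chosen representatives; when theta is a congruence the
   choice is immaterial. *)
Definition quotient A (theta : A -> A -> Prop) : algebra S :=
  @Algebra S (eq_class theta)
    (fun f C => class_of theta (interp (fun i => repr (C i)))).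

Implicit Type K : algebra S -> Prop.

Definition free_over K (X : Type) F (g : X -> F) : Prop :=
  K F /\
  forall B, K B -> forall v : X -> B,
    exists! h : F -> B, homomorphism h /\ forall x, h (g x) = v x.

Definition finitely_presented K A : Prop :=
  exists (n : nat) (F : algebra S) (g : 'I_n -> F) (r : seq (F * F)),
    free_over K g /\
    isomorphic A (quotient (generated_congruence (fun a b => List.In (a, b) r))).

Definition coherent K : Prop :=
  forall A, K A -> finitely_presented K A ->
  forall s : seq A,
    finitely_presented K (generated_subalgebra (fun a => List.In a s)).

End Algebras.

Inductive term (S : signature) (X : Type) : Type :=
| Var of X
| App (f : op S) of ('I_(arity f) -> term S X).

Arguments Var {S X}.
Arguments App {S X}.

Section Equations.
Variable S : signature.

Fixpoint eval (X : Type) (A : algebra S) (e : X -> A) (t : term S X) : A :=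
  match t with
  | Var x => e x
  | App f ts => interp (fun i => eval e (ts i))
  end.

Fixpoint occurs (X : Type) (x : X) (t : term S X) : Prop :=
  match t with
  | Var y => x = y
  | App f ts => exists i, occurs x (ts i)
  end.

(* The countably infinite supply of variables is nat. *)
Definition equation : Type := (term S nat * term S nat)%type.

Definition equation_in (P : nat -> Prop) (eps : equation) : Prop :=
  forall x, occurs x eps.1 \/ occurs x eps.2 -> P x.

Definition holds (A : algebra S) (e : nat -> A) (eps : equation) : Prop :=
  eval e eps.1 = eval e eps.2.

Definition consequence (K : algebra S -> Prop) (Sigma : seq equation)
    (eps : equation) : Prop :=
  forall A, K A -> forall e : nat -> A,
    (forall sigma, List.In sigma Sigma -> holds e sigma) -> holds e eps.

Definition right_uniform_deductive_interpolation (K : algebra S -> Prop) : Prop :=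
  forall x y : seq nat, (forall v, ~ (v \in x /\ v \in y)) ->
  forall Sigma : seq equation,
    (forall sigma, List.In sigma Sigma ->
       equation_in (fun v => v \in x \/ v \in y) sigma) ->
  exists Pi : seq equation,
    (forall pi, List.In pi Pi -> equation_in (fun v => v \in y) pi) /\
    forall (z : nat -> Prop), (forall v, z v -> v \notin x /\ v \notin y) ->
    forall eps, equation_in (fun v => v \in y \/ z v) eps ->
      (consequence K Sigma eps <-> consequence K Pi eps).

End Equations.

(* The free variables of a formula S n are the elements of 'I_n, and FAll binds
   ord0.  The other connectives and the existential quantifier are classically
   definable. *)
Inductive formula (S : signature) : nat -> Type :=
| FFalse n : formula S n
| FEq n : term S 'I_n -> term S 'I_n -> formula S n
| FImp n : formula S n -> formula S n -> formula S n
| FAll n : formula S n.+1 -> formula S n.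

Arguments FFalse {S n}.
Arguments FEq {S n}.
Arguments FImp {S n}.
Arguments FAll {S n}.

Notation sentence S := (formula S 0).

Definition FNot (S : signature) n (phi : formula S n) : formula S n :=
  FImp phi FFalse.

Definition extend (T : Type) n (a : T) (e : 'I_n -> T) (i : 'I_n.+1) : T :=
  if unlift ord0 i is Some j then e j else a.

Definition no_vars (T : Type) (i : 'I_0) : T :=
  False_rect T (notF (ltn_ord i)).

Section FirstOrder.
Variable S : signature.

Fixpoint sat (A : algebra S) n (phi : formula S n) : ('I_n -> A) -> Prop :=
  match phi in formula _ n return ('I_n -> A) -> Prop with
  | FFalse _ => fun _ => False
  | FEq _ t u => fun e => eval e t = eval e u
  | FImp _ p q => fun e => sat p e -> sat q e
  | FAll _ p => fun e => forall a : A, sat p (extend a e)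
  end.

Definition satisfies (A : algebra S) (phi : sentence S) : Prop :=
  sat phi (no_vars A).

Definition theory : Type := sentence S -> Prop.

Definition models (A : algebra S) (T : theory) : Prop :=
  forall phi, T phi -> satisfies A phi.

Definition entails (T : theory) (phi : sentence S) : Prop :=
  forall A : algebra S, models A T -> satisfies A phi.

Definition complete (T : theory) : Prop :=
  forall phi : sentence S, entails T phi \/ entails T (FNot phi).

Definition theory_of (K : algebra S -> Prop) : theory :=
  fun phi => forall A, K A -> satisfies A phi.

Fixpoint quantifier_free n (phi : formula S n) : Prop :=
  match phi with
  | FFalse _ | FEq _ _ _ => True
  | FImp _ p q => quantifier_free p /\ quantifier_free q
  | FAll _ _ => False
  end.

End FirstOrder.

Definition add_constants (S : signature) (C : Type) : signature :=
  @Signature (op S + C)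
    (fun o => match o with inl f => arity f | inr _ => 0 end).

Section Constants.
Variables (S : signature) (C : Type).

Fixpoint lift_term (X : Type) (t : term S X) : term (add_constants S C) X :=
  match t with
  | Var x => Var x
  | App f ts => @App (add_constants S C) X (inl f) (fun i => lift_term (ts i))
  end.

Fixpoint lift_formula n (phi : formula S n) : formula (add_constants S C) n :=
  match phi with
  | FFalse _ => FFalse
  | FEq _ t u => FEq (lift_term t) (lift_term u)
  | FImp _ p q => FImp (lift_formula p) (lift_formula q)
  | FAll _ p => FAll (lift_formula p)
  end.

Definition lift_theory (T : theory S) : theory (add_constants S C) :=
  fun phi => exists2 psi, T psi & phi = lift_formula psi.

Definition expansion (A : algebra S) (c : C -> A) : algebra (add_constants S C) :=
  @Algebra (add_constants S C) A
    (fun o => match o return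
                ('I_(@arity (add_constants S C) o) -> A) -> A with
              | inl f => @interp S A f
              | inr x => fun _ => c x
              end).

End Constants.

Section ModelCompletion.
Variable S : signature.

(* Each element of M is named by itself. *)
Definition qf_diagram (M : algebra S) : theory (add_constants S M) :=
  fun phi => quantifier_free phi /\ satisfies (expansion (fun m : M => m)) phi.

Definition model_completion (T Tstar : theory S) : Prop :=
  [/\ forall phi, T phi -> Tstar phi,
      forall M, models M T ->
        exists N, models N Tstar /\ exists h : M -> N, embedding h
    & forall M, models M T ->
        complete (fun phi => @lift_theory S M Tstar phi \/ qf_diagram phi)].

End ModelCompletion.

Section Lattices.
Variable T : Type.

Record bounded_lattice (meet join : T -> T -> T) (bot top : T) : Prop :=
  BoundedLattice {
    bl_meetC : commutative meet;
    bl_meetA : associative meet;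
    bl_joinC : commutative join;
    bl_joinA : associative join;
    bl_joinK : forall x y, meet x (join x y) = x;
    bl_meetK : forall x y, join x (meet x y) = x;
    bl_bot : forall x, join bot x = x;
    bl_top : forall x, meet top x = x
  }.

Definition lattice_le (meet : T -> T -> T) (x y : T) : Prop := meet x y = x.

Record heyting_algebra (meet join imp : T -> T -> T) (bot top : T) : Prop :=
  HeytingAlgebra {
    ha_lattice : bounded_lattice meet join bot top;
    ha_residuation : forall x y z,
      lattice_le meet (meet x y) z <-> lattice_le meet x (imp y z)
  }.

Record dual_heyting_algebra (meet join sub : T -> T -> T) (bot top : T) : Prop :=
  DualHeytingAlgebra {
    dha_lattice : bounded_lattice meet join bot top;
    dha_residuation : forall x y z,
      lattice_le meet (sub x y) z <-> lattice_le meet x (join y z)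
  }.

End Lattices.

Inductive dh_op : Type := Meet | Join | Imp | Sub | Bot | Top.

Definition dh_signature : signature :=
  @Signature dh_op
    (fun o => match o with Meet | Join | Imp | Sub => 2 | Bot | Top => 0 end).

Section DoubleHeyting.
Variable A : algebra dh_signature.

Definition dh_meet (x y : A) : A := @interp _ A Meet (tnth [tuple x; y]).
Definition dh_join (x y : A) : A := @interp _ A Join (tnth [tuple x; y]).
Definition dh_imp (x y : A) : A := @interp _ A Imp (tnth [tuple x; y]).
Definition dh_sub (x y : A) : A := @interp _ A Sub (tnth [tuple x; y]).
Definition dh_bot : A := @interp _ A Bot (no_vars A).
Definition dh_top : A := @interp _ A Top (no_vars A).

Definition double_heyting : Prop :=
  heyting_algebra dh_meet dh_join dh_imp dh_bot dh_top /\
  dual_heyting_algebra dh_meet dh_join dh_sub dh_bot dh_top.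

End DoubleHeyting.

(* Main.v *)
(* Let t x = (1 - x) -> 0 and consider the equations z <= y <= x, y <= t y.
   They entail z <= t^k x for every k.  A finite set of equations in x and z
   equivalent to them, as far as consequences in x and z go, would follow from
   coherence as well as from interpolation, and cannot exist.  Indeed, take the
   upsets of two disjoint half-infinite fences, let x consist of all points but
   the end of the left fence, z of the end of the right fence and y of the whole
   right fence.  Every upset generated by x and z is constant far from the two
   ends, so linking the two fences at a far away height n does not change any
   given term in x and z.  Once they are linked, however, an upset y with
   y <= t y is a union of components, so no y lies between z and x.

   For model completions, the algebra M generated by x and z embeds, on the one
   hand, into the upsets of the unlinked fences, where y exists, and on the other
   hand into an ultraproduct of models of the completion extending the upsets of
   the fences linked at height n, where no y exists; so "there is no such y" is
   not decided by the completion together with the diagram of M. *)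
From Stdlib Require List.
From mathcomp Require Import all_boot.
From mathcomp Require Import boolp classical_sets filter.
Require Import Defs.

Set Implicit Arguments.
Unset Strict Implicit.
Unset Printing Implicit Defensive.

(** * Universal algebra *)

Lemma In_map (T U : Type) (f : T -> U) (s : seq T) b :
  List.In b (map f s) <-> exists a, f a = b /\ List.In a s.
Proof. exact: List.in_map_iff. Qed.

Section UniversalAlgebra.
Variable S : signature.
Implicit Types (A B C : algebra S) (X Y : Type).

Fixpoint subst X Y (u : X -> term S Y) (t : term S X) : term S Y :=
  match t with
  | Var x => u x
  | App f ts => App f (fun i => subst u (ts i))
  end.

Lemma eval_subst X Y A (u : X -> term S Y) (e : Y -> A) t :
  eval e (subst u t) = eval (fun x => eval e (u x)) t.
Proof.
elim: t => [//|f ts IH] /=; congr (interp _); apply: funext => i; exact: IH.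
Qed.

Lemma occurs_subst X Y (u : X -> term S Y) (P : Y -> Prop) t :
  (forall x y, occurs y (u x) -> P y) -> forall y, occurs y (subst u t) -> P y.
Proof.
by move=> uP; elim: t => [x|f ts IH] y /=; [exact: uP | case=> i; exact: IH].
Qed.

Lemma eval_ext X A (e e' : X -> A) t :
  (forall x, occurs x t -> e x = e' x) -> eval e t = eval e' t.
Proof.
elim: t => [x|f ts IH] /= ee'; first exact: ee'.
congr (interp _); apply: funext => i; apply: IH => x xi.
by apply: ee'; exists i.
Qed.

Lemma hom_eval X A B (h : A -> B) (e : X -> A) t :
  homomorphism h -> h (eval e t) = eval (fun x => h (e x)) t.
Proof.
move=> hh; elim: t => [//|f ts IH] /=; rewrite hh.
by congr (interp _); apply: funext => i; exact: IH.
Qed.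

Lemma hom_comp A B C (h : A -> B) (k : B -> C) :
  homomorphism h -> homomorphism k -> homomorphism (fun a => k (h a)).
Proof. by move=> hh hk f a; rewrite hh hk. Qed.

Lemma hom_can A B (h : A -> B) (k : B -> A) :
  homomorphism h -> cancel h k -> cancel k h -> homomorphism k.
Proof.
move=> hh hK kK f b; apply: (can_inj hK); rewrite kK hh.
by congr (interp _); apply: funext => i; rewrite kK.
Qed.

Lemma kernel_congruence A B (h : A -> B) :
  homomorphism h -> congruence (fun a b => h a = h b).
Proof.
move=> hh; split=> // [a b c -> //|f a b ab]; rewrite !hh.
by congr (interp _); apply: funext.
Qed.

Lemma generated_congruenceP A (R : A -> A -> Prop) :
  congruence (generated_congruence R).
Proof.
split=> [a|a b ab|a b c ab bc|f a b ab] th hth Rth.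
- exact: cong_refl.
- exact: cong_sym (ab th hth Rth).
- exact: cong_trans (ab th hth Rth) (bc th hth Rth).
- by apply: cong_interp => // i; exact: ab.
Qed.

(** The values of terms with variables in [P] form a subuniverse containing [G]. Tracking [P] is
    what later confines the interpolant to the variables [y]. *)
Lemma generated_term X A (e : X -> A) (P : X -> Prop) (G : A -> Prop) a :
  (forall b, G b -> exists2 x, P x & b = e x) -> generated G a ->
  exists t : term S X, (forall x, occurs x t -> P x) /\ a = eval e t.
Proof.
move=> Ge Ga.
apply: (Ga (fun a => exists t, (forall x, occurs x t -> P x) /\ a = eval e t));
  last first.
  by move=> b /Ge[x Px ->]; exists (Var x); split=> // y /= ->.
move=> f b /choice[ts hts]; exists (App f ts); split=> [x [i]|/=].
  exact: (hts i).1.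
by congr (interp _); apply: funext => i; exact: (hts i).2.
Qed.

(** * Quotients by congruences *)

Section Quotient.
Variables (A : algebra S) (theta : A -> A -> Prop).

Lemma class_repr (c : quotient theta) : class_of theta (repr c) = c.
Proof.
case: c => c hc; apply: eq_exist.
by rewrite /repr; case: (cid _).
Qed.

Hypothesis thetaP : congruence theta.

Lemma class_eqP a b : class_of theta a = class_of theta b <-> theta a b.
Proof.
split=> [ab|ab].
  by rewrite (congr1 sval ab : theta a = theta b); exact: cong_refl.
apply: eq_exist; apply: funext => c; apply: propext; split.
  exact: (cong_trans thetaP (cong_sym thetaP ab)).
exact: (cong_trans thetaP ab).
Qed.

Lemma repr_class a : theta (repr (class_of theta a)) a.
Proof. by apply/class_eqP; exact: class_repr. Qed.

Lemma class_hom : homomorphism (class_of theta : A -> quotient theta).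
Proof.
move=> f a; apply/class_eqP; apply: cong_interp => // i.
by apply: (cong_sym thetaP); exact: repr_class.
Qed.

(** The map induced on the quotient is written [fun c => h (repr c)]; with the next lemma this gives
    the existence half of the universal property. *)
Lemma quotient_lift_class B (h : A -> B) a :
  (forall b c, theta b c -> h b = h c) -> h (repr (class_of theta a)) = h a.
Proof. by apply; exact: repr_class. Qed.

Lemma quotient_lift_hom B (h : A -> B) :
  homomorphism h -> (forall b c, theta b c -> h b = h c) ->
  homomorphism (fun c : quotient theta => h (repr c)).
Proof.
by move=> hh hth f c; rewrite -hh; apply: (hth); exact: repr_class.
Qed.

End Quotient.

(** * Free algebras: terms modulo the identities of the class *)

Section Free.
Variable K : algebra S -> Prop.

Definition term_algebra X : algebra S := @Algebra S (term S X) (@App S X).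

Definition identity_of X (s t : term_algebra X) : Prop :=
  forall A, K A -> forall e : X -> A, eval e s = eval e t.

Definition free_algebra X : algebra S := quotient (@identity_of X).

Lemma identity_congruence X : congruence (@identity_of X).
Proof.
split=> [//|s t st A KA e|s t u st tu A KA e|f s t st A KA e] /=.
- by rewrite st.
- by rewrite st // tu.
- by congr (interp _); apply: funext => i; exact: st.
Qed.

Definition free_var X (x : X) : free_algebra X :=
  class_of (@identity_of X) (Var x : term_algebra X).

Lemma free_algebra_term X (c : free_algebra X) :
  exists t, c = eval (@free_var X) t.
Proof.
exists (repr (c : quotient (@identity_of X)) : term_algebra X).
rewrite -[LHS](class_repr (c : quotient (@identity_of X))).
elim: (@repr _ (term_algebra X) _ _) => [//|f ts IH] /=.
apply: etrans (class_hom (@identity_congruence X) ts) _.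
by apply: (congr1 (@interp S (free_algebra X) f)); apply: funext => i; exact: IH.
Qed.

Lemma free_algebra_free X :
  K (free_algebra X) -> free_over K (@free_var X).
Proof.
move=> KF; split=> // B KB v.
have vhom : homomorphism (eval v : term_algebra X -> B) by [].
have evth b c : identity_of b c -> eval v b = eval v c by apply.
exists (fun c : quotient (@identity_of X) => eval v (repr c : term_algebra X)).
have lhom := quotient_lift_hom (@identity_congruence X) vhom evth.
have lvar x := quotient_lift_class (@identity_congruence X) (Var x) evth.
split=> [//|h [hh hv]]; apply: funext => c.
have [t ->] := free_algebra_term c.
rewrite (hom_eval _ _ lhom) (hom_eval _ _ hh).
by congr eval; apply: funext => x; rewrite hv; exact: lvar.
Qed.

Lemma free_ext X (F B : algebra S) (g : X -> F) (h k : F -> B) : K B -> free_over K g ->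
  homomorphism h -> homomorphism k -> (forall x, h (g x) = k (g x)) -> h = k.
Proof.
move=> KB [_ Fg] hh hk hg; have [l [_ lu]] := Fg _ KB (fun x => k (g x)).
by rewrite -(lu h) // -(lu k).
Qed.

(** Of [F] only the universal property is known. The composite of the comparison maps from [F] to
    the term model and back fixes the generators, hence is the identity, so every element comes from
    a term. *)
Lemma free_term X (F : algebra S) (g : X -> F) (a : F) : K (free_algebra X) ->
  free_over K g -> exists t : term S X, a = eval g t.
Proof.
move=> KT Fg.
have [i [[hi ig] _]] := Fg.2 _ KT (@free_var X).
have [j [[hj jg] _]] := (free_algebra_free KT).2 _ Fg.1 g.
have ji : (fun b => j (i b)) = id.
  apply: (free_ext Fg.1 Fg) => //; first exact: hom_comp.
  by move=> x; rewrite ig jg.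
have [t it] := free_algebra_term (i a).
exists t; rewrite -[LHS](congr1 (fun k => k a) ji) it (hom_eval _ _ hj).
by congr eval; apply: funext => x.
Qed.

End Free.

End UniversalAlgebra.

Lemma In_mem (T : eqType) (a : T) (s : seq T) : List.In a s <-> a \in s.
Proof.
elim: s => //= b s IH; rewrite inE; split=> [[->|/IH ->]|/orP[/eqP ->|/IH]].
- by rewrite eqxx.
- by rewrite orbT.
- by left.
- by right.
Qed.

(** * From coherence to finite interpolants *)

Section Coherence.
Variables (S : signature) (K : algebra S -> Prop).
Hypothesis K_free : forall X : Type, K (free_algebra K X).
Hypothesis K_quotient : forall (A : algebra S) (theta : A -> A -> Prop),
  K A -> congruence theta -> K (quotient theta).

(** Let [A] be the algebra presented by [Sigma]. The consequences of [Sigma] in [y] are the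
    equations true of the elements of [A] named by [y], hence of the subalgebra they generate. By
    coherence that subalgebra has a finite presentation, and rewriting it in terms over [y] gives
    [Pi]. *)
Lemma coherent_interpolant (x y : seq nat) (Sigma : seq (equation S)) :
  coherent K ->
  (forall sigma, List.In sigma Sigma ->
     equation_in (fun v => v \in x \/ v \in y) sigma) ->
  exists Pi : seq (equation S),
    (forall pi, List.In pi Pi -> equation_in (fun v => v \in y) pi) /\
    forall eps, equation_in (fun v => v \in y) eps ->
      (consequence K Sigma eps <-> consequence K Pi eps).
Proof.
move=> cohK Sxy.
pose vs := x ++ y.
(* The last generator is a dummy value for the variables outside [vs]. *)
pose ix (v : nat) : 'I_(size vs).+1 := inord (index v vs).
have nth_ix (v : nat) : v \in vs -> nth 0 vs (ix v) = v.
  by move=> vvs; rewrite inordK ?nth_index // ltnS index_size.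
pose F := free_algebra K 'I_(size vs).+1.
pose g i : F := @free_var _ K _ i.
have Fg : free_over K g by apply: free_algebra_free.
pose eF (v : nat) := g (ix v).
pose r : seq (F * F) := [seq (eval eF s.1, eval eF s.2) | s <- Sigma].
pose th : F -> F -> Prop := generated_congruence (fun a b => List.In (a, b) r).
have thP : congruence th by apply: generated_congruenceP.
pose A := quotient th.
have KA : K A by apply: K_quotient thP; exact: Fg.1.
pose eA (v : nat) : A := class_of th (eF v).
have eAE t : eval eA t = class_of th (eval eF t).
  by rewrite (hom_eval eF t (class_hom thP)).
have SA sigma : List.In sigma Sigma -> holds eA sigma.
  move=> Ss; rewrite /holds !eAE; apply/(class_eqP thP) => th' _; apply.
  by apply/In_map; exists sigma.
(* Every solution of [Sigma] in [B] is the image of [eA] under a homomorphism from [A], so [eA] is a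
   generic solution. *)
have AB (B : algebra S) (e : nat -> B) : K B -> (forall s, List.In s Sigma -> holds e s) ->
    exists2 h : A -> B, homomorphism h & forall v, v \in vs -> h (eA v) = e v.
  move=> KB Se; have [h [[hh hg] _]] := Fg.2 _ KB (fun i => e (nth 0 vs i)).
  have hth a b : th a b -> h a = h b.
    move=> /(_ _ (kernel_congruence hh)); apply.
    move=> _ _ /In_map[s [[<- <-] Ss]]; rewrite !(hom_eval _ _ hh).
    have eE t : (forall v, occurs v t -> v \in vs) ->
        eval (fun v => h (eF v)) t = eval e t.
      by move=> tv; apply: eval_ext => v /tv vvs; rewrite hg nth_ix.
    have sv v : occurs v s.1 \/ occurs v s.2 -> v \in vs.
      by move=> /(Sxy s Ss) vxy; rewrite mem_cat; apply/orP.
    rewrite !eE; [exact: Se | by move=> v ?; apply: sv; right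
                            | by move=> v ?; apply: sv; left].
  exists (fun c => h (repr c)); first exact: (quotient_lift_hom thP).
  by move=> v vvs; rewrite (quotient_lift_class thP) // hg nth_ix.
have yvs (v : nat) : v \in y -> v \in vs by rewrite mem_cat => ->; rewrite orbT.
have consE eps : equation_in (fun v => v \in y) eps ->
    consequence K Sigma eps <-> holds eA eps.
  move=> ey; split; first by apply.
  move=> eAe B KB e Se; have [h hh hv] := AB _ _ KB Se.
  have eE t : (forall v, occurs v t -> v \in y) -> eval e t = h (eval eA t).
    move=> tv; rewrite (hom_eval _ _ hh).
    by apply: eval_ext => v /tv /yvs /hv.
  rewrite /holds !eE; [by congr (h _) | by move=> v ?; apply: ey; right
                                     | by move=> v ?; apply: ey; left].
pose s := map eA y.
pose G a := List.In a s.
have Fin : finitely_presented K A.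
  by exists (size vs).+1, F, g, r; split=> //; exists id; split=> //; exists id.
have [n [F' [g' [r' [Fg' [phi [phih [psi phiK psiK]]]]]]]] := cohK A KA Fin s.
pose th' := generated_congruence (fun a b => List.In (a, b) r').
have th'P : congruence th' by apply: generated_congruenceP.
pose B0 := generated_subalgebra G.
have psih : homomorphism psi by apply: (hom_can phih).
have svalh : homomorphism (sval : B0 -> A) by [].
(* Two translations: [tm] writes an element of [F'] as a term in the generators of the new
   presentation, and [u] writes the image of each such generator in [A] as a term over [y]. *)
have [tm tmE] := choice (fun a => free_term a (K_free 'I_n) Fg').
have Gy b : G b -> exists2 v, v \in y & b = eA v.
  by move=> /In_map[v [<- /In_mem vy]]; exists v.
have [u uP] := choice (fun j => generated_term Gy
  (svalP (psi (class_of th' (g' j) : quotient th')))).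
(* The relations [r'] alone do not tie the variables [y] to the new generators; [b0 v] says that [v]
   equals its own expression through them. The trivial equation is a default that does not arise for
   [v] in [y]. *)
pose b0 (v : nat) := match pselect (generated G (eA v)) with
  | left pf => (subst u (tm (repr (phi (exist _ _ pf)))), Var v)
  | right _ => (Var v, Var v) : equation S
  end.
pose Pi : seq (equation S) :=
  [seq (subst u (tm ab.1), subst u (tm ab.2)) | ab <- r'] ++ map b0 y.
have occu t v : occurs v (subst u t) -> v \in y.
  apply: (@occurs_subst _ _ _ u (fun v => v \in y)) => j w; exact: (uP j).1.
have psihr : homomorphism (fun a => sval (psi (class_of th' a : quotient th')) : A).
  by apply: hom_comp svalh; apply: hom_comp psih; exact: class_hom.
have evu (a : F') : eval eA (subst u (tm a)) = sval (psi (class_of th' a)).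
  rewrite eval_subst [in RHS](tmE a) (hom_eval g' _ psihr).
  by congr eval; apply: funext => j; rewrite -(uP j).2.
have Piy pi : List.In pi Pi -> equation_in (fun v => v \in y) pi.
  move=> /List.in_app_iff[] /In_map[].
    by move=> ab [<- _] v [] /occu.
  move=> v [<- /In_mem vy] w; rewrite /b0; case: pselect => [pf|_].
    by case=> [/occu//|/= ->].
  by case=> /= ->.
have PiA pi : List.In pi Pi -> holds eA pi.
  move=> /List.in_app_iff[] /In_map[].
    move=> [a b] [<- abr]; rewrite /holds !evu; congr (sval (psi _)).
    by apply/(class_eqP th'P) => th'' _; apply.
  move=> v [<- _]; rewrite /b0; case: pselect => // pf.
  by rewrite /holds evu class_repr phiK.
exists Pi; split=> // eps ey; rewrite (consE _ ey); split; last first.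
  by apply.
move=> eAeps C KC e PiC.
(* A solution of [Pi] in [C] sends the new generators to the values of [u]. The translated relations
   make this map factor through the presentation, which gives [H : B0 -> C]. *)
have [k [[kh kg] _]] := Fg'.2 _ KC (fun j => eval e (u j)).
have kE a : k a = eval e (subst u (tm a)).
  rewrite eval_subst [in LHS](tmE a) (hom_eval g' _ kh).
  by congr eval; apply: funext.
have kth a b : th' a b -> k a = k b.
  move=> /(_ _ (kernel_congruence kh)); apply.
  move=> {}a {}b abr; rewrite !kE; apply: (PiC (_, _)).
  by apply/List.in_app_iff; left; apply/In_map; exists (a, b).
pose H (b : B0) := k (repr (phi b)).
have Hh : homomorphism H by exact: hom_comp phih (quotient_lift_hom th'P kh kth).
(* [H] carries the elements named by [y] to their values under [e]; at a variable this is the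
   equation [b0 v]. *)
have Hy t : (forall v, occurs v t -> v \in y) ->
    exists b : B0, sval b = eval eA t /\ H b = eval e t.
  elim: t => [v|f ts IH] ty; last first.
    have [|b bP] := @choice _ _ (fun i b => sval b = eval eA (ts i) /\ H b = eval e (ts i)).
      by move=> i; apply: IH => v vi; apply: ty; exists i.
    exists (@interp _ B0 f b); split.
      by apply: (congr1 (@interp S A f)); apply: funext => i; exact: (bP i).1.
    rewrite (Hh f b); apply: (congr1 (@interp S C f)).
    by apply: funext => i; exact: (bP i).2.
  have vy : v \in y by exact: ty.
  have pf : generated G (eA v).
    by move=> P _ GP; apply: GP; apply/In_map; exists v; split=> //; apply/In_mem.
  exists (exist _ _ pf); split=> //=; rewrite /H kE.
  suff /PiC : List.In (b0 v) Pi.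
    rewrite /b0; case: pselect => // pf'.
    by rewrite /holds /= (Prop_irrelevance pf' pf).
  by apply/List.in_app_iff; right; apply/In_map; exists v; split=> //; apply/In_mem.
have [b1 [b1A b1C]] : exists b : B0, sval b = eval eA eps.1 /\ H b = eval e eps.1.
  by apply: Hy => v ?; apply: ey; left.
have [b2 [b2A b2C]] : exists b : B0, sval b = eval eA eps.2 /\ H b = eval e eps.2.
  by apply: Hy => v ?; apply: ey; right.
rewrite /holds -b1C -b2C; congr H.
apply: eq_sig_hprop => [a|]; first exact: Prop_irrelevance.
by rewrite b1A b2A.
Qed.

End Coherence.

(** * Double-Heyting algebras *)

Section BoundedLattice.
Variables (T : Type) (meet join : T -> T -> T) (bot top : T).
Hypothesis L : bounded_lattice meet join bot top.
Local Notation "x <= y" := (lattice_le meet x y).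

Lemma blatt_refl x : x <= x.
Proof. by rewrite /lattice_le -{2}(bl_meetK L x x) (bl_joinK L). Qed.

Lemma blatt_trans x y z : x <= y -> y <= z -> x <= z.
Proof. by rewrite /lattice_le => <- yz; rewrite -(bl_meetA L) yz. Qed.

Lemma blatt_meetl x y : meet x y <= x.
Proof.
by rewrite /lattice_le (bl_meetC L x) -(bl_meetA L) [meet x x]blatt_refl.
Qed.

Lemma blatt_meetr x y : meet x y <= y.
Proof. by rewrite (bl_meetC L); exact: blatt_meetl. Qed.

Lemma blatt_joinl x y : x <= join x y.
Proof. exact: bl_joinK L x y. Qed.

Lemma blatt_joinr x y : y <= join x y.
Proof. by rewrite (bl_joinC L); exact: blatt_joinl. Qed.

Lemma blatt_joinP x y : x <= y <-> join x y = y.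
Proof.
split=> [<-|<-]; last exact: blatt_joinl.
by rewrite (bl_joinC L) (bl_meetC L) (bl_meetK L).
Qed.

Lemma blatt_lub x y z : x <= z -> y <= z -> join x y <= z.
Proof.
move=> /blatt_joinP xz /blatt_joinP yz; apply/blatt_joinP.
by rewrite -(bl_joinA L) yz.
Qed.

End BoundedLattice.

Local Notation "x <=_ A y" := (lattice_le (@dh_meet A) x y)
  (at level 70, A at next level).

Lemma fun_ord2 (T : Type) (a : 'I_2 -> T) :
  a = tnth [tuple a ord0; a ord_max].
Proof.
apply: funext => i; case: i => [[|[|//]]] hi; congr (a _); exact: val_inj.
Qed.

(** * Homomorphisms and embeddings of double-Heyting algebras *)

Section Homomorphisms.
Variables (A B : algebra dh_signature) (h : A -> B).
Hypothesis hh : homomorphism h.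

Lemma comp_tnth2 (T U : Type) (f : T -> U) (x y : T) :
  (fun i => f (tnth [tuple x; y] i)) = tnth [tuple f x; f y].
Proof. exact: fun_ord2. Qed.

Lemma hom_meet x y : h (dh_meet x y) = dh_meet (h x) (h y).
Proof. by rewrite /dh_meet hh comp_tnth2. Qed.

Lemma hom_join x y : h (dh_join x y) = dh_join (h x) (h y).
Proof. by rewrite /dh_join hh comp_tnth2. Qed.

Lemma hom_imp x y : h (dh_imp x y) = dh_imp (h x) (h y).
Proof. by rewrite /dh_imp hh comp_tnth2. Qed.

Lemma hom_sub x y : h (dh_sub x y) = dh_sub (h x) (h y).
Proof. by rewrite /dh_sub hh comp_tnth2. Qed.

Lemma hom_bot : h (dh_bot A) = dh_bot B.
Proof. by rewrite /dh_bot hh; congr (interp _); apply: funext => -[]. Qed.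

Lemma hom_top : h (dh_top A) = dh_top B.
Proof. by rewrite /dh_top hh; congr (interp _); apply: funext => -[]. Qed.

End Homomorphisms.

(** The axioms are universal and the order is equational, so an injective homomorphism reflects
    them. *)
Lemma embedding_double_heyting (A B : algebra dh_signature) (h : A -> B) :
  embedding h -> double_heyting B -> double_heyting A.
Proof.
move=> [hh hi] HB; have LB := ha_lattice HB.1.
have hE := (hom_meet hh, hom_join hh, hom_imp hh, hom_sub hh, hom_bot hh, hom_top hh).
have leE x y : lattice_le (@dh_meet A) x y <-> lattice_le (@dh_meet B) (h x) (h y).
  by rewrite /lattice_le -(hom_meet hh); split=> [->|/hi].
have L : bounded_lattice (@dh_meet A) (@dh_join A) (dh_bot A) (dh_top A).
  split.
  - by move=> x y; apply: hi; rewrite !hE; exact: bl_meetC LB _ _.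
  - by move=> x y z; apply: hi; rewrite !hE; exact: bl_meetA LB _ _ _.
  - by move=> x y; apply: hi; rewrite !hE; exact: bl_joinC LB _ _.
  - by move=> x y z; apply: hi; rewrite !hE; exact: bl_joinA LB _ _ _.
  - by move=> x y; apply: hi; rewrite !hE; exact: bl_joinK LB _ _.
  - by move=> x y; apply: hi; rewrite !hE; exact: bl_meetK LB _ _.
  - by move=> x; apply: hi; rewrite !hE; exact: bl_bot LB _.
  - by move=> x; apply: hi; rewrite !hE; exact: bl_top LB _.
split; split=> // x y z; rewrite !leE !hE.
- exact: ha_residuation HB.1 _ _ _.
- exact: dha_residuation HB.2 _ _ _.
Qed.

(** * Quotients and free double-Heyting algebras *)

Section Congruences.
Variables (A : algebra dh_signature) (theta : A -> A -> Prop).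
Hypothesis thetaP : congruence theta.

Lemma cong_tnth2 x y z t : theta x y -> theta z t ->
  forall i, theta (tnth [tuple x; z] i) (tnth [tuple y; t] i).
Proof. by move=> xy zt [[|[|//]]] hi; rewrite !(tnth_nth x). Qed.

Lemma cong_meet x y z t :
  theta x y -> theta z t -> theta (dh_meet x z) (dh_meet y t).
Proof. by move=> xy zt; apply: cong_interp => //; exact: cong_tnth2. Qed.

Lemma cong_join x y z t :
  theta x y -> theta z t -> theta (dh_join x z) (dh_join y t).
Proof. by move=> xy zt; apply: cong_interp => //; exact: cong_tnth2. Qed.

Lemma cong_imp x y z t :
  theta x y -> theta z t -> theta (dh_imp x z) (dh_imp y t).
Proof. by move=> xy zt; apply: cong_interp => //; exact: cong_tnth2. Qed.

Lemma cong_sub x y z t :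
  theta x y -> theta z t -> theta (dh_sub x z) (dh_sub y t).
Proof. by move=> xy zt; apply: cong_interp => //; exact: cong_tnth2. Qed.

Definition lattice_le_mod x y := theta (dh_meet x y) x.

(** The axioms are required modulo [theta] only, so that the lemma applies to the term algebra,
    where they fail on the nose, as well as to double-Heyting algebras. *)
Lemma quotient_double_heyting :
  (forall x y, theta (dh_meet x y) (dh_meet y x)) ->
  (forall x y z, theta (dh_meet x (dh_meet y z)) (dh_meet (dh_meet x y) z)) ->
  (forall x y, theta (dh_join x y) (dh_join y x)) ->
  (forall x y z, theta (dh_join x (dh_join y z)) (dh_join (dh_join x y) z)) ->
  (forall x y, theta (dh_meet x (dh_join x y)) x) ->
  (forall x y, theta (dh_join x (dh_meet x y)) x) ->
  (forall x, theta (dh_join (dh_bot A) x) x) ->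
  (forall x, theta (dh_meet (dh_top A) x) x) ->
  (forall x y z, lattice_le_mod (dh_meet x y) z <-> lattice_le_mod x (dh_imp y z)) ->
  (forall x y z, lattice_le_mod (dh_sub x y) z <-> lattice_le_mod x (dh_join y z)) ->
  double_heyting (quotient theta).
Proof.
move=> mC mA jC jA jK mK bj tm ri rs.
have ch := class_hom thetaP.
have cE := class_eqP thetaP.
have all1 (P : quotient theta -> Prop) : (forall x, P (class_of theta x)) -> forall c, P c.
  by move=> Px c; rewrite -(class_repr c).
have L : bounded_lattice (@dh_meet (quotient theta)) (@dh_join (quotient theta))
    (dh_bot (quotient theta)) (dh_top (quotient theta)).
  split; rewrite -?(hom_bot ch) -?(hom_top ch).
  - by do 2 elim/all1 => ?; rewrite -!(hom_meet ch); exact/cE.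
  - by do 3 elim/all1 => ?; rewrite -!(hom_meet ch); exact/cE.
  - by do 2 elim/all1 => ?; rewrite -!(hom_join ch); exact/cE.
  - by do 3 elim/all1 => ?; rewrite -!(hom_join ch); exact/cE.
  - by do 2 elim/all1 => ?; rewrite -(hom_join ch) -(hom_meet ch); exact/cE.
  - by do 2 elim/all1 => ?; rewrite -(hom_meet ch) -(hom_join ch); exact/cE.
  - by elim/all1 => ?; rewrite -(hom_join ch); exact/cE.
  - by elim/all1 => ?; rewrite -(hom_meet ch); exact/cE.
split; split=> //; do 3 elim/all1 => ?; rewrite /lattice_le.
- by rewrite -(hom_imp ch) -!(hom_meet ch) !cE; exact: ri.
- by rewrite -(hom_sub ch) -(hom_join ch) -!(hom_meet ch) !cE; exact: rs.
Qed.

End Congruences.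

(** Congruent terms are those equal under every evaluation in every double-Heyting algebra, so each
    axiom is inherited from these; residuation is applied evaluation by evaluation. *)
Lemma free_double_heyting X : double_heyting (free_algebra double_heyting X).
Proof.
have HL B (HB : double_heyting B) := ha_lattice HB.1.
have eh (B : algebra dh_signature) (e : X -> B) :
  homomorphism (eval e : term_algebra dh_signature X -> B) by [].
have rE B e := (hom_meet (eh B e), hom_join (eh B e), hom_imp (eh B e),
  hom_sub (eh B e), hom_bot (eh B e), hom_top (eh B e)).
apply: (quotient_double_heyting (@identity_congruence _ _ X)).
- by move=> x y B HB e; rewrite !rE; exact: bl_meetC (HL B HB) _ _.
- by move=> x y z B HB e; rewrite !rE; exact: bl_meetA (HL B HB) _ _ _.
- by move=> x y B HB e; rewrite !rE; exact: bl_joinC (HL B HB) _ _.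
- by move=> x y z B HB e; rewrite !rE; exact: bl_joinA (HL B HB) _ _ _.
- by move=> x y B HB e; rewrite !rE; exact: bl_joinK (HL B HB) _ _.
- by move=> x y B HB e; rewrite !rE; exact: bl_meetK (HL B HB) _ _.
- by move=> x B HB e; rewrite !rE; exact: bl_bot (HL B HB) _.
- by move=> x B HB e; rewrite !rE; exact: bl_top (HL B HB) _.
- by move=> x y z; split=> xyz B HB e; have := xyz B HB e;
     rewrite !rE; apply (ha_residuation HB.1).
- by move=> x y z; split=> xyz B HB e; have := xyz B HB e;
     rewrite !rE; apply (dha_residuation HB.2).
Qed.

Section DoubleHeytingTheory.
Variable A : algebra dh_signature.
Hypothesis HA : double_heyting A.
Local Notation "x <= y" := (lattice_le (@dh_meet A) x y).
Let L := ha_lattice HA.1.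

Lemma dh_le_imp x y : x <= dh_imp y (dh_meet x y).
Proof. by apply/(ha_residuation HA.1); exact: blatt_refl L _. Qed.

Lemma dh_imp_meet x y : dh_meet (dh_imp x y) x <= y.
Proof. by apply/(ha_residuation HA.1); exact: blatt_refl L _. Qed.

Lemma dh_le_join_sub x y : x <= dh_join y (dh_sub x y).
Proof. by apply/(dha_residuation HA.2); exact: blatt_refl L _. Qed.

Lemma dh_le_meet2l x y z : x <= y -> dh_meet x z <= dh_meet y z.
Proof.
rewrite /lattice_le => xy.
rewrite (bl_meetA L) -(bl_meetA L x) (bl_meetC L z) (bl_meetA L) xy.
by rewrite -(bl_meetA L) [dh_meet z z](blatt_refl L).
Qed.

Lemma dh_le_imp2 x y z : y <= z -> dh_imp x y <= dh_imp x z.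
Proof.
move=> yz; apply/(ha_residuation HA.1); exact: (blatt_trans L) (dh_imp_meet x y) yz.
Qed.

Lemma dh_imp_anti x y z : x <= y -> dh_imp y z <= dh_imp x z.
Proof.
move=> xy; apply/(ha_residuation HA.1).
apply: (blatt_trans L) _ (dh_imp_meet y z).
by rewrite (bl_meetC L) (bl_meetC L _ y); exact: dh_le_meet2l.
Qed.

Lemma dh_sub_anti x y z : x <= y -> dh_sub z y <= dh_sub z x.
Proof.
move=> xy; apply/(dha_residuation HA.2).
apply: (blatt_trans L) (dh_le_join_sub z x) _.
apply: (blatt_lub L); last exact: (blatt_joinr L).
by apply: (blatt_trans L) xy _; exact: (blatt_joinl L).
Qed.

(** Residuation is an equivalence of inequalities and does not pass to classes directly. Each
    direction replaces [x] by a congruent element for which the conclusion holds exactly. *)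
Lemma quotient_of_double_heyting (theta : A -> A -> Prop) :
  congruence theta -> double_heyting (quotient theta).
Proof.
move=> thP; have th0 := cong_refl thP; have thS := cong_sym thP; have thT := cong_trans thP.
have eqth x y : x = y -> theta x y by move=> ->; exact: th0.
apply: (quotient_double_heyting thP).
- by move=> x y; apply: eqth; exact: bl_meetC L _ _.
- by move=> x y z; apply: eqth; exact: bl_meetA L _ _ _.
- by move=> x y; apply: eqth; exact: bl_joinC L _ _.
- by move=> x y z; apply: eqth; exact: bl_joinA L _ _ _.
- by move=> x y; apply: eqth; exact: bl_joinK L _ _.
- by move=> x y; apply: eqth; exact: bl_meetK L _ _.
- by move=> x; apply: eqth; exact: bl_bot L _.
- by move=> x; apply: eqth; exact: bl_top L _.
- move=> x y z; rewrite /lattice_le_mod; split=> xyz.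
  (* [x] equals its meet with [dh_imp y m], and [m] is congruent to its meet with [z]. *)
  + set m := dh_meet x y in xyz; pose w := dh_meet x (dh_imp y (dh_meet m z)).
    have xw : theta x w.
      rewrite -{1}[x](dh_le_imp x y : _ = _); apply: (cong_meet thP) => //.
      by apply: (cong_imp thP) => //; exact: thS.
    have wyz : dh_meet w (dh_imp y z) = w.
      apply: (blatt_trans L) (blatt_meetr L _ _) _; apply: dh_le_imp2.
      exact: (blatt_meetr L).
    by apply: thT (thS _ _ xw); rewrite -wyz; exact: cong_meet.
  + set v := dh_meet x (dh_imp y z) in xyz.
    have vyz : dh_meet (dh_meet v y) z = dh_meet v y.
      apply: (blatt_trans L) _ (dh_imp_meet y z).
      by apply: dh_le_meet2l; exact: (blatt_meetr L).
    have vx : theta (dh_meet v y) (dh_meet x y) by exact: cong_meet.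
    apply: thT vx; rewrite -vyz; apply: cong_meet => //.
    by apply: cong_meet => //; exact: thS.
- move=> x y z; rewrite /lattice_le_mod; split=> xyz.
  (* Likewise [x] equals its meet with [dh_join y s], and [s] is congruent to its meet with [z]. *)
  + set s := dh_sub x y in xyz; pose w := dh_meet x (dh_join y (dh_meet s z)).
    have xw : theta x w.
      rewrite -{1}[x](dh_le_join_sub x y : _ = _); apply: (cong_meet thP) => //.
      by apply: (cong_join thP) => //; exact: thS.
    have wyz : dh_meet w (dh_join y z) = w.
      apply: (blatt_trans L) (blatt_meetr L _ _) _.
      apply: (blatt_lub L); first exact: (blatt_joinl L).
      by apply: (blatt_trans L) (blatt_meetr L _ _) _; exact: (blatt_joinr L).
    by apply: thT (thS _ _ xw); rewrite -wyz; exact: cong_meet.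
  + set v := dh_meet x (dh_join y z) in xyz.
    have vyz : dh_meet (dh_sub v y) z = dh_sub v y.
      by apply/(dha_residuation HA.2); exact: (blatt_meetr L).
    have vx : theta (dh_sub v y) (dh_sub x y) by exact: cong_sub.
    apply: thT vx; rewrite -vyz; apply: cong_meet => //.
    by apply: cong_sub => //; exact: thS.
Qed.

End DoubleHeytingTheory.

(** * The equations z <= y <= x, y <= t y *)

Definition term_meet X (s t : term dh_signature X) : term dh_signature X :=
  @App dh_signature X Meet (tnth [tuple s; t]).

Definition term_core X (s : term dh_signature X) : term dh_signature X :=
  @App dh_signature X Imp
    (tnth [tuple @App dh_signature X Sub
                  (tnth [tuple @App dh_signature X Top (no_vars _); s]);
                @App dh_signature X Bot (no_vars _)]).

(** The map t: the pseudocomplement of the dual pseudocomplement. *)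
Definition dh_core (A : algebra dh_signature) (x : A) : A :=
  dh_imp (dh_sub (dh_top A) x) (dh_bot A).

Lemma eval_meet X (A : algebra dh_signature) (e : X -> A) s t :
  eval e (term_meet s t) = dh_meet (eval e s) (eval e t).
Proof. by rewrite /= comp_tnth2. Qed.

Lemma eval_core X (A : algebra dh_signature) (e : X -> A) s :
  eval e (term_core s) = dh_core (eval e s).
Proof.
by rewrite /= comp_tnth2 /= comp_tnth2 /=; congr dh_imp; first congr dh_sub;
  congr (interp _); apply: funext => -[].
Qed.

Definition le_eqn X (s t : term dh_signature X) := (term_meet s t, s).

Lemma holds_le (A : algebra dh_signature) (e : nat -> A) s t :
  holds e (le_eqn s t) <-> lattice_le (@dh_meet A) (eval e s) (eval e t).
Proof. by rewrite /holds eval_meet. Qed.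

(** The variables 0, 1, 2 stand for y, x, z. *)
Definition fixpoint_equations : seq (equation dh_signature) :=
  [:: le_eqn (Var 2) (Var 0); le_eqn (Var 0) (Var 1);
      le_eqn (Var 0) (term_core (Var 0))].

Definition core_equation k : equation dh_signature :=
  le_eqn (Var 2) (iter k (@term_core nat) (Var 1)).

Lemma occurs_meet X (s t : term dh_signature X) v :
  occurs v (term_meet s t) -> occurs v s \/ occurs v t.
Proof. by case=> i; case: i => [[|[|//]] hi] st; [left|right]. Qed.

Lemma occurs_core X (s : term dh_signature X) v :
  occurs v (term_core s) -> occurs v s.
Proof.
case=> i; case: i => [[|[|//]] hi] /= [j]; last by case: j.
by case: j => [[|[|//]] hj] //= [[]].
Qed.

Lemma core_equation_in k :
  equation_in (fun v => v \in [:: 1; 2]) (core_equation k).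
Proof.
have ck v : occurs v (iter k (@term_core nat) (Var 1)) -> v = 1.
  by elim: k => [//|k IH] vk; apply: IH; apply: occurs_core vk.
by move=> v [vk|/= ->//]; case: (occurs_meet vk) => [/= ->//|/ck ->].
Qed.

Lemma fixpoint_equations_in sigma : List.In sigma fixpoint_equations ->
  equation_in (fun v => v \in [:: 0] \/ v \in [:: 1; 2]) sigma.
Proof.
move=> [<-|[<-|[<-|[]]]] v [vk|/=].
- by case: (occurs_meet vk) => /= ->; rewrite !inE; [right|left].
- by move=> ->; right.
- by case: (occurs_meet vk) => /= ->; rewrite !inE; [left|right].
- by move=> ->; left.
- by left; case: (occurs_meet vk) => [/= ->//|vk']; rewrite (occurs_core vk').
- by move=> ->; left.
Qed.

Definition assign (T : Type) (y x z : T) (v : nat) : T :=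
  match v with 0 => y | 1 => x | _ => z end.

Lemma holds_fixpoint_equations (A : algebra dh_signature) (e : nat -> A) :
  (forall sigma, List.In sigma fixpoint_equations -> holds e sigma) <->
  [/\ lattice_le (@dh_meet A) (e 2) (e 0), lattice_le (@dh_meet A) (e 0) (e 1)
    & lattice_le (@dh_meet A) (e 0) (dh_core (e 0))].
Proof.
split=> [H|[zy yx yt] sigma [<-|[<-|[<-|[]]]]].
- have h0 := H _ (or_introl erefl); have h1 := H _ (or_intror (or_introl erefl)).
  have h2 := H _ (or_intror (or_intror (or_introl erefl))).
  by move: h0 h1 h2; rewrite !holds_le eval_core.
- exact/holds_le.
- exact/holds_le.
- by apply/holds_le; rewrite eval_core.
Qed.

Lemma holds_core_equation (A : algebra dh_signature) (e : nat -> A) k :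
  holds e (core_equation k) <->
  lattice_le (@dh_meet A) (e 2) (iter k (@dh_core A) (e 1)).
Proof.
rewrite holds_le; suff -> : eval e (iter k (@term_core nat) (Var 1)) =
  iter k (@dh_core A) (e 1) by [].
by elim: k => [//|k IH]; rewrite !iterS -IH eval_core.
Qed.

Lemma dh_core_mono (A : algebra dh_signature) (x y : A) : double_heyting A ->
  lattice_le (@dh_meet A) x y ->
  lattice_le (@dh_meet A) (dh_core x) (dh_core y).
Proof. by move=> HA xy; apply: (dh_imp_anti HA); exact: dh_sub_anti. Qed.

(** As t is monotone, induction from y <= x gives y <= t y <= t (t^k x). *)
Lemma fixpoint_core (A : algebra dh_signature) (e : nat -> A) k :
  double_heyting A ->
  (forall sigma, List.In sigma fixpoint_equations -> holds e sigma) ->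
  holds e (core_equation k).
Proof.
move=> HA /holds_fixpoint_equations[zy yx yt]; apply/holds_core_equation.
have L := ha_lattice HA.1.
apply: (blatt_trans L) zy _; elim: k => [//|k IH]; rewrite iterS.
exact: (blatt_trans L) yt (dh_core_mono HA IH).
Qed.

(** * The double-Heyting algebra of upsets of a preorder *)

Section Upsets.
Variables (X : Type) (R : X -> X -> Prop).

Definition upset (U : X -> Prop) : Prop := forall p q, R p q -> U p -> U q.

(** For a preorder [R], [imp_set U V] is the largest upset that meets [U] inside [V], and
    [sub_set U V] the least upset containing the part of [U] outside [V]. *)
Definition imp_set (U V : X -> Prop) (p : X) : Prop :=
  forall q, R p q -> U q -> V q.
Definition sub_set (U V : X -> Prop) (p : X) : Prop :=
  exists q, [/\ R q p, U q & ~ V q].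

Hypothesis R_refl : forall p, R p p.
Hypothesis R_trans : forall p q r, R p q -> R q r -> R p r.

Lemma upset_meet U V : upset U -> upset V -> upset (fun p => U p /\ V p).
Proof. by move=> hU hV p q pq [/(hU _ _ pq) ? /(hV _ _ pq)]. Qed.

Lemma upset_join U V : upset U -> upset V -> upset (fun p => U p \/ V p).
Proof.
by move=> hU hV p q pq [/(hU _ _ pq)|/(hV _ _ pq)]; [left|right].
Qed.

Lemma upset_const (P : Prop) : upset (fun _ => P).
Proof. by []. Qed.

Lemma upset_imp U V : upset (imp_set U V).
Proof. by move=> p q pq UV r /(R_trans pq); exact: UV. Qed.

Lemma upset_sub U V : upset (sub_set U V).
Proof.
by move=> p q pq [r [rp Ur Vr]]; exists r; split=> //; exact: R_trans pq.
Qed.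

Definition upset_algebra : algebra dh_signature :=
  @Algebra dh_signature {U : X -> Prop | upset U} (fun f =>
    match f return ('I_(@arity dh_signature f) -> {U : X -> Prop | upset U}) -> _ with
    | Meet => fun a => exist _ _ (upset_meet (svalP (a ord0)) (svalP (a ord_max)))
    | Join => fun a => exist _ _ (upset_join (svalP (a ord0)) (svalP (a ord_max)))
    | Imp => fun a => exist _ _ (@upset_imp (sval (a ord0)) (sval (a ord_max)))
    | Sub => fun a => exist _ _ (@upset_sub (sval (a ord0)) (sval (a ord_max)))
    | Bot => fun _ => exist _ _ (@upset_const False)
    | Top => fun _ => exist _ _ (@upset_const True)
    end).

Implicit Types U V : upset_algebra.

Lemma upset_ext U V : (forall p, sval U p <-> sval V p) -> U = V.
Proof.
case: U V => [U hU] [V hV] UV; apply: eq_exist; apply: funext => p.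
exact/propext/UV.
Qed.

Lemma upset_le U V :
  lattice_le (@dh_meet upset_algebra) U V <-> forall p, sval U p -> sval V p.
Proof.
split=> [<- p []//|UV]; apply: upset_ext => p; split=> [[]//|Up].
by split=> //; exact: UV.
Qed.

Lemma upset_double_heyting : double_heyting upset_algebra.
Proof.
have L : bounded_lattice (@dh_meet upset_algebra) (@dh_join upset_algebra)
    (dh_bot upset_algebra) (dh_top upset_algebra).
  split.
  - by move=> U V; apply: upset_ext => p /=; tauto.
  - by move=> U V W; apply: upset_ext => p /=; tauto.
  - by move=> U V; apply: upset_ext => p /=; tauto.
  - by move=> U V W; apply: upset_ext => p /=; tauto.
  - by move=> U V; apply: upset_ext => p /=; tauto.
  - by move=> U V; apply: upset_ext => p /=; tauto.
  - by move=> U; apply: upset_ext => p /=; tauto.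
  - by move=> U; apply: upset_ext => p /=; tauto.
split; split=> // U V W; rewrite !upset_le; split=> UVW p.
- by move=> Up q pq Vq; apply: UVW; split=> //; exact: (svalP U) pq Up.
- by move=> [Up Vp]; exact: UVW Up p (R_refl p) Vp.
- move=> Up; case: (pselect (sval V p)) => [Vp|Vp]; first by left.
  by right; apply: UVW; exists p.
- move=> [q [qp /UVW[Vq|Wq] nVq]]; first by case: nVq.
  exact: (svalP W) qp Wq.
Qed.

(** The upset 1 - U is generated by the complement of [U], and its pseudocomplement consists of the
    points with nothing above them in it. *)
Lemma upset_core U p :
  sval (dh_core U) p <-> forall q r, R p q -> R r q -> sval U r.
Proof.
split=> [pU q r pq rq|pU q pq [r [rq _]]]; last by apply; exact: pU rq.
by apply: contrapT => Ur; apply: (pU q pq); exists r.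
Qed.

End Upsets.

(** * Fences *)

Definition point : Type := (bool * nat)%type.

(* [(s, i)] is the point at distance [i] from the end of the right ([s = true]) or
   left half fence; the right end is maximal and the left end minimal. *)
Definition maximal (p : point) : bool := p.1 (+) odd p.2.

(* The two halves are linked at the heights satisfying [N]. *)
Definition adjacent (N : pred nat) (p q : point) : bool :=
  if p.1 == q.1 then (q.2 == p.2.+1) || (p.2 == q.2.+1)
  else (p.2 == q.2) && N p.2.

Definition fence (N : pred nat) (p q : point) : Prop :=
  p = q \/ [/\ ~~ maximal p, maximal q & adjacent N p q].

Lemma fence_refl N p : fence N p p.
Proof. by left. Qed.

(** Proper steps lead from a minimal to a maximal point, so no two of them compose. *)
Lemma fence_trans N p q r : fence N p q -> fence N q r -> fence N p r.
Proof.
case=> [->//|[pm qm pq]] [<-|[qm']]; first by right.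
by rewrite qm in qm'.
Qed.

Definition fence_algebra N : algebra dh_signature :=
  upset_algebra (@fence_trans N).

Lemma fence_double_heyting N : double_heyting (fence_algebra N).
Proof. by apply: upset_double_heyting; exact: fence_refl. Qed.

Lemma adjacent_succ N s i : adjacent N (s, i) (s, i.+1).
Proof. by rewrite /adjacent eqxx /= eqxx. Qed.

Lemma adjacentC N p q : adjacent N p q = adjacent N q p.
Proof.
rewrite /adjacent (eq_sym q.1); case: eqP => _; first by rewrite orbC.
by rewrite (eq_sym q.2); case: eqP => // ->.
Qed.

(** The two ends lie on different levels, so linking points of equal height still joins a minimal
    point to a maximal one. *)
Lemma adjacent_maximal N p q : adjacent N p q -> maximal q = ~~ maximal p.
Proof.
case: p q => [s i] [s' j]; rewrite /adjacent /maximal /=.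
case: (eqVneq s s') => [->|ss'].
  by case/orP=> /eqP -> /=; rewrite ?addbN ?negbK.
by case/andP=> /eqP -> _; case: s s' ss' => [] [] //= _; rewrite ?negbK.
Qed.

Lemma fence_adjacent N p q : adjacent N p q -> fence N p q \/ fence N q p.
Proof.
move=> pq; have qm := adjacent_maximal pq.
case pm: (maximal p) qm => /= qm; [right|left]; right; split=> //.
- by rewrite qm.
- by rewrite adjacentC.
- by rewrite pm.
Qed.

(** A neighbour above [p] is in [Y] because [Y] is an upset, a neighbour below [p] because of y <= t
    y. Hence [Y] is a union of components. *)
Lemma core_fixpoint_closed N (Y : fence_algebra N) :
  lattice_le (@dh_meet _) Y (dh_core Y) ->
  forall p q, adjacent N p q -> sval Y p -> sval Y q.
Proof.
move=> /upset_le Yt p q /fence_adjacent[pq|qp] Yp; first exact: (svalP Y) pq Yp.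
move/upset_core: (Yt p Yp) => /(_ p q); apply=> //.
exact: fence_refl.
Qed.

(** Walk along the right half up to height [n], cross the link, and walk back to the left end. *)
Lemma core_fixpoint_linked n (Y : fence_algebra (pred1 n)) :
  lattice_le (@dh_meet _) Y (dh_core Y) ->
  sval Y (true, 0) -> sval Y (false, 0).
Proof.
move=> /core_fixpoint_closed Yadj Y0.
have up i : sval Y (true, i).
  by elim: i => // i; apply: Yadj; exact: adjacent_succ.
(* Here [i] counts the steps after the link, so the left end is reached at [i = n]. *)
have down i : i <= n -> sval Y (false, n - i).
  elim: i => [_|i IH ni].
    by rewrite subn0; apply: Yadj (up n); rewrite /adjacent /= !eqxx.
  apply: Yadj (IH (ltnW ni)); rewrite adjacentC.
  by rewrite -(subnSK ni); exact: adjacent_succ.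
by rewrite -(subnn n); exact: down.
Qed.

Lemma left_end_upset N : upset (fence N) (fun p => p <> (false, 0)).
Proof. by move=> p q [->//|[_ qm _]] _ q0; move: qm; rewrite q0. Qed.

Lemma right_end_upset N : upset (fence N) (fun p => p = (true, 0)).
Proof. by move=> p q [->//|[pm _ _]] p0; move: pm; rewrite p0. Qed.

Definition off_left_end N : fence_algebra N := exist _ _ (@left_end_upset N).
Definition right_end N : fence_algebra N := exist _ _ (@right_end_upset N).

Lemma no_fixpoint_linked n (Y : fence_algebra (pred1 n)) :
  lattice_le (@dh_meet _) (right_end _) Y -> lattice_le (@dh_meet _) Y (off_left_end _) ->
  lattice_le (@dh_meet _) Y (dh_core Y) -> False.
Proof.
move=> /upset_le cY /upset_le Ya /core_fixpoint_linked Y0.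
by apply: (Ya _ (Y0 (cY (true, 0) erefl))).
Qed.

(** On upsets t commutes with intersections. If z were below all iterates of x, their intersection
    [Y] would satisfy y <= t y and lie between z and x, which the link excludes. *)
Lemma core_iterate_linked n :
  exists k, ~ lattice_le (@dh_meet _) (right_end (pred1 n))
    (iter k (@dh_core _) (off_left_end _)).
Proof.
apply: contrapT => /forallNP call.
have {}call k :
    lattice_le (@dh_meet _) (right_end (pred1 n)) (iter k (@dh_core _) (off_left_end _)).
  exact: contrapT (call k).
pose Y p := forall k, sval (iter k (@dh_core _) (off_left_end (pred1 n))) p.
have hY : upset (fence (pred1 n)) Y.
  move=> p q pq Yp k.
  exact: (svalP (iter k (@dh_core (fence_algebra (pred1 n))) (off_left_end _))) _ _ pq (Yp k).
apply: (@no_fixpoint_linked n (exist _ _ hY)); apply/upset_le => p.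
- by move=> cp k; exact: (upset_le _ _).1 (call k) _ cp.
- by move=> /(_ 0).
- move=> Yp; apply/upset_core => q r pq rq k.
  exact: (upset_core _ _).1 (Yp k.+1) q r pq rq.
Qed.

Lemma unlinked_upset (P : bool -> Prop) : upset (fence pred0) (fun p => P p.1).
Proof.
by move=> p q [->//|[_ _]]; rewrite /adjacent andbF; case: eqP => // ->.
Qed.

Definition right_half : fence_algebra pred0 := exist _ _ (@unlinked_upset id).

Lemma unlinked_fixpoint : [/\ lattice_le (@dh_meet _) (right_end pred0) right_half,
  lattice_le (@dh_meet _) right_half (off_left_end pred0)
  & lattice_le (@dh_meet _) right_half (dh_core right_half)].
Proof.
have adj p q : fence pred0 p q -> p.1 = q.1.
  by case=> [->//|[_ _]]; rewrite /adjacent andbF; case: eqP.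
split; apply/upset_le => p; first by move=> /= ->.
- by move=> /= p1 p0; move: p1; rewrite p0.
- move=> p1; apply/upset_core => q r /adj pq /adj rq.
  by move: p1; rewrite /= rq -pq.
Qed.

(** One and the same [b] serves both halves, so a link at height [n0] or beyond joins points of
    equal membership. *)
Definition constant_beyond n0 (U : point -> Prop) : Prop :=
  exists b, forall p, n0 <= p.2 -> U p = b.

Lemma constant_beyondW n0 n1 U :
  n0 <= n1 -> constant_beyond n0 U -> constant_beyond n1 U.
Proof. by move=> n01 [b Ub]; exists b => p /(leq_trans n01)/Ub. Qed.

Lemma fence_near N p q : fence N p q -> p.2 <= q.2.+1 /\ q.2 <= p.2.+1.
Proof.
case=> [->//|[_ _]]; rewrite /adjacent; case: ifP => _; last first.
  by case/andP => /eqP -> _; rewrite leqnSn.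
by case/orP => /eqP ->; split=> //; rewrite ltnW // ltnW.
Qed.

(** Comparable points differ in height by at most one, which costs one level. *)
Lemma imp_set_constant N n0 U V : constant_beyond n0 U -> constant_beyond n0 V ->
  constant_beyond n0.+1 (imp_set (fence N) U V).
Proof.
move=> [u Uu] [v Vv]; exists (u -> v) => p n0p; apply: propext; split=> [UV|uv q].
  rewrite -(Uu p (ltnW n0p)) -(Vv p (ltnW n0p)); apply: UV; exact: fence_refl.
move=> /fence_near[pq _]; have n0q : n0 <= q.2 by rewrite -ltnS (leq_trans n0p).
by rewrite Uu // Vv.
Qed.

Lemma sub_set_constant N n0 U V : constant_beyond n0 U -> constant_beyond n0 V ->
  constant_beyond n0.+1 (sub_set (fence N) U V).
Proof.
move=> [u Uu] [v Vv]; exists (u /\ ~ v) => p n0p; apply: propext; split=> [|uv].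
  move=> [q [/fence_near[_ pq]]].
  by have n0q : n0 <= q.2 by [rewrite -ltnS (leq_trans n0p)]; rewrite Uu // Vv.
exists p; rewrite Uu ?Vv ?(ltnW n0p) //; split; [exact: fence_refl | |]; tauto.
Qed.

Lemma fence_linked n p q : fence (pred1 n) p q ->
  fence pred0 p q \/ p.2 = n /\ q.2 = n.
Proof.
case=> [->|[pm qm pq]]; first by left; left.
move: (pq); rewrite /adjacent; case: ifP => [pq1 pq2|_ /andP[/eqP pq2 /eqP pn]].
  by left; right; split=> //; rewrite /adjacent pq1.
by right; rewrite -pq2.
Qed.

Lemma fence_unlinked N p q : fence pred0 p q -> fence N p q.
Proof.
case=> [->|[pm qm]]; first by left.
rewrite /adjacent andbF; case: eqP => // pq pq2; right.
by split=> //; rewrite /adjacent pq eqxx.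
Qed.

(** The link adds only comparisons between points of height [n], where [U] and [V] are constant;
    there [p] itself can replace the new point. *)
Lemma imp_set_linked n0 n U V : constant_beyond n0 U -> constant_beyond n0 V ->
  n0 <= n -> imp_set (fence (pred1 n)) U V = imp_set (fence pred0) U V.
Proof.
move=> [u Uu] [v Vv] n0n; apply: funext => p; apply: propext.
split=> UV q pq; first by apply: UV; exact: fence_unlinked.
case: (fence_linked pq) => [|[pn qn]]; first exact: UV.
have := UV p (fence_refl _ _).
by rewrite !Uu ?Vv ?pn ?qn.
Qed.

Lemma sub_set_linked n0 n U V : constant_beyond n0 U -> constant_beyond n0 V ->
  n0 <= n -> sub_set (fence (pred1 n)) U V = sub_set (fence pred0) U V.
Proof.
move=> [u Uu] [v Vv] n0n; apply: funext => p; apply: propext.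
split=> -[q [qp Uq Vq]]; last by exists q; split=> //; exact: fence_unlinked.
case: (fence_linked qp) => [qp'|[qn pn]]; first by exists q.
exists p; move: Uq Vq; rewrite !Uu ?Vv ?pn ?qn //; split=> //; exact: fence_refl.
Qed.

Lemma upset_linked n0 n (U : fence_algebra pred0) : constant_beyond n0 (sval U) ->
  n0 <= n -> upset (fence (pred1 n)) (sval U).
Proof.
move=> [u Uu] n0n p q /fence_linked[|[pn qn]]; first exact: (svalP U).
by rewrite !Uu ?pn ?qn.
Qed.

(** * Upsets constant far from the ends *)

Local Open Scope classical_set_scope.

(** By [constant_beyondW] one bound would do; the filter form lets finitely many such conditions be
    combined. *)
Definition tame (U : fence_algebra pred0) : Prop :=
  \forall n \near \oo, constant_beyond n (sval U).

Lemma tame_subuniverse : subuniverse tame.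
Proof.
(* The arguments are finitely many, so a common bound exists. *)
move=> f a /filter_forall; case: f a => a.
- move=> [n _ na]; exists n => // m nm.
  have [u Uu] := na m nm ord0; have [v Vv] := na m nm ord_max.
  by exists (u /\ v) => p mp /=; rewrite Uu ?Vv.
- move=> [n _ na]; exists n => // m nm.
  have [u Uu] := na m nm ord0; have [v Vv] := na m nm ord_max.
  by exists (u \/ v) => p mp /=; rewrite Uu ?Vv.
(* Implication and subtraction lose one level, so constancy of the arguments is used at [m] to get
   it at [m.+1]. *)
- move=> [n _ na]; exists n.+1 => // -[//|m] nm.
  by apply: imp_set_constant; exact: na.
- move=> [n _ na]; exists n.+1 => // -[//|m] nm.
  by apply: sub_set_constant; exact: na.
- by move=> _; apply: nearW => n; exists False.
- by move=> _; apply: nearW => n; exists True.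
Qed.

(* For every tame [U], the junk value [dh_top] only occurs at small [n]. *)
Definition cut n (U : fence_algebra pred0) : fence_algebra (pred1 n) :=
  match pselect (upset (fence (pred1 n)) (sval U)) with
  | left hU => exist _ _ hU
  | right _ => dh_top _
  end.

Lemma sval_cut n U : constant_beyond n (sval U) -> sval (cut n U) = sval U.
Proof. by rewrite /cut; case: pselect => // hU /upset_linked/(_ (leqnn _)). Qed.

(** For large [n] the arguments and the value are constant beyond [n], so [cut n] keeps them, and
    the link changes neither implication nor subtraction. *)
Lemma cut_interp (f : op dh_signature)
    (a : 'I_(arity f) -> fence_algebra pred0) :
  (forall i, tame (a i)) ->
  \forall n \near \oo, cut n (interp a) = interp (fun i => cut n (a i)).
Proof.
move=> ta; have := tame_subuniverse ta; apply: filter_app.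
move/filter_forall: ta; apply: filterS => n na ni.
have nE i : sval (cut n (a i)) = sval (a i) by exact: sval_cut.
apply: upset_ext => p; rewrite (sval_cut ni) {ni}.
case: f a na nE p => /= a na nE p; rewrite ?nE //.
- by rewrite (imp_set_linked (na ord0) (na ord_max) (leqnn n)).
- by rewrite (sub_set_linked (na ord0) (na ord_max) (leqnn n)).
Qed.

Lemma cut_inj U V : tame U -> tame V -> U <> V ->
  \forall n \near \oo, cut n U <> cut n V.
Proof.
move=> tU tV UV; apply: filterS2 tU tV => n nU nV cUV; apply: UV.
by apply: upset_ext => p; rewrite -(sval_cut nU) -(sval_cut nV) cUV.
Qed.

Lemma constant_left_end : constant_beyond 1 (fun p => p <> (false, 0)).
Proof. by exists True => -[s [//|i]] _; apply: propext. Qed.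

Lemma constant_right_end : constant_beyond 1 (fun p => p = (true, 0)).
Proof. by exists False => -[s [//|i]] _; apply: propext. Qed.

Lemma tame_a : tame (off_left_end _).
Proof. by exists 1 => // n /constant_beyondW; apply; exact: constant_left_end. Qed.

Lemma tame_c : tame (right_end _).
Proof. by exists 1 => // n /constant_beyondW; apply; exact: constant_right_end. Qed.

Lemma cut_a : \forall n \near \oo, cut n (off_left_end _) = off_left_end _.
Proof.
by apply: filterS tame_a => n na; apply: upset_ext => p; rewrite sval_cut.
Qed.

Lemma cut_c : \forall n \near \oo, cut n (right_end _) = right_end _.
Proof.
by apply: filterS tame_c => n na; apply: upset_ext => p; rewrite sval_cut.
Qed.

Lemma tame_eval X (e : X -> fence_algebra pred0) t :
  (forall x, tame (e x)) -> tame (eval e t).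
Proof. by move=> te; elim: t => //= f ts IH; exact: tame_subuniverse. Qed.

(** A term contains finitely many operations, so [cut n] commutes with all of them for large [n]. *)
Lemma cut_eval X (e : X -> fence_algebra pred0) t : (forall x, tame (e x)) ->
  \forall n \near \oo, cut n (eval e t) = eval (fun x => cut n (e x)) t.
Proof.
move=> te; elim: t => [x|f ts IH] /=; first exact: nearW.
have := cut_interp (fun i => tame_eval (ts i) te); apply: filter_app.
move/filter_forall: IH; apply: filterS => n IH ->.
apply: (congr1 (@interp _ (fence_algebra (pred1 n)) f)); exact: funext.
Qed.

(** * Failure of interpolation and coherence *)

Lemma no_interpolant (Pi : seq (equation dh_signature)) :
  (forall pi, List.In pi Pi -> equation_in (fun v => v \in [:: 1; 2]) pi) ->
  (forall eps, equation_in (fun v => v \in [:: 1; 2]) eps ->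
    consequence double_heyting fixpoint_equations eps <->
    consequence double_heyting Pi eps) -> False.
Proof.
move=> Pi12 PiE.
pose e0 := assign right_half (off_left_end pred0) (right_end _).
(* [right_half] is not tame, so [e] replaces it at the variable 0, which does not occur in [Pi], by
   a tame value. *)
pose e := assign (off_left_end pred0) (off_left_end _) (right_end _).
have te v : tame (e v) by case: v => [|[|v]]; [exact: tame_a..|exact: tame_c].
have Pie pi : List.In pi Pi -> holds e pi.
  move=> Pipi; have pi12 := Pi12 _ Pipi.
  (* Members of [Pi] follow from [Pi], hence from the fixpoint equations, and [e0] satisfies
     these. *)
  have : holds e0 pi.
    apply: ((PiE _ pi12).2 _) (fence_double_heyting _) _ _.
      by move=> A HA f; apply.
    exact/holds_fixpoint_equations/unlinked_fixpoint.
  rewrite /holds; have eE t : (forall v, occurs v t -> v \in [:: 1; 2]) ->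
      eval e0 t = eval e t.
    move=> tv; apply: eval_ext => v /tv.
    by rewrite !inE => /orP[] /eqP ->.
  by rewrite !eE // => v ?; apply: pi12; [right|left].
(* [Pi] is finite, and each of its equations survives cutting for large [n]. *)
have Pin : \forall n \near \oo, forall pi, List.In pi Pi ->
    holds (fun v => cut n (e v)) pi.
  elim: Pi Pie {Pi12 PiE} => [|pi Pi IH] Pie; first exact: nearW.
  have {}IH := IH (fun q hq => Pie q (or_intror hq)).
  have := cut_eval pi.1 te; apply: filter_app.
  have := cut_eval pi.2 te; apply: filter_app.
  apply: filterS IH => n IH pi2 pi1 q [<-|]; last exact: IH.
  by rewrite /holds -pi1 -pi2 (Pie pi) //; left.
(* At such an [n], [Pi] would force z <= t^k x in the linked fences for every [k]. *)
have [n [[na nc] nPi]] := filter_ex (filterI (filterI cut_a cut_c) Pin).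
have [k] := core_iterate_linked n; apply.
have : holds (fun v => cut n (e v)) (core_equation k).
  apply: ((PiE _ _).1 _) (fence_double_heyting _) _ nPi.
    exact: core_equation_in.
  by move=> A HA f; exact: fixpoint_core.
by move/holds_core_equation; rewrite /= na nc.
Qed.

Lemma not_right_uniform_interpolation :
  ~ right_uniform_deductive_interpolation double_heyting.
Proof.
move=> rudi.
have disj v : ~ (v \in [:: 0] /\ v \in [:: 1; 2]).
  by rewrite !inE => -[/eqP ->].
have [|Pi [Pi12 PiE]] := rudi _ _ disj fixpoint_equations.
  exact: fixpoint_equations_in.
apply: (no_interpolant Pi12) => eps eps12.
(* Equations without further variables are enough for the contradiction, so the set of those
   variables is empty. *)
apply: (PiE (fun _ => False)) => // v /eps12; by left.
Qed.

Lemma not_coherent : ~ coherent double_heyting.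
Proof.
move=> coh.
have [Pi [Pi12 PiE]] := coherent_interpolant free_double_heyting
  (fun A th HA => @quotient_of_double_heyting A HA th) coh fixpoint_equations_in.
exact: (no_interpolant Pi12).
Qed.

(** * Ultraproducts *)

Lemma extend0 (T : Type) n (a : T) (e : 'I_n -> T) : extend a e ord0 = a.
Proof. by rewrite /extend unlift_none. Qed.

Lemma extendS (T : Type) n (a : T) (e : 'I_n -> T) i :
  extend a e (lift ord0 i) = e i.
Proof. by rewrite /extend liftK. Qed.

Lemma comp_extend (T U : Type) n (f : T -> U) (a : T) (e : 'I_n -> T) :
  (fun i => f (extend a e i)) = extend (f a) (fun i => f (e i)).
Proof. by apply: funext => i; rewrite /extend; case: unlift. Qed.

Section Ultraproduct.
Variables (S : signature) (N : nat -> algebra S) (F : set_system nat).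
Hypothesis UF : UltraFilter F.
(* One empty factor would empty the product, and break the case of [FAll]. *)
Variable x0 : forall n, N n.

Definition product_algebra : algebra S :=
  @Algebra S (forall n, N n) (fun f a n => interp (fun i => a i n)).

Definition almost_eq (a b : product_algebra) : Prop := F [set n | a n = b n].

Lemma almost_eq_congruence : congruence almost_eq.
Proof.
split.
- by move=> a; apply: nearW.
- by move=> a b; apply: filterS => n.
- by move=> a b c; apply: filterS2 => n /= -> .
- move=> f a b /(filter_forall _); apply: filterS => n ab /=.
  by congr (interp _); apply: funext.
Qed.

Definition ultraproduct : algebra S := quotient almost_eq.

Lemma ultra_not (P : set nat) : ~ F P <-> F (~` P).
Proof.
split=> [nP|FnP FP]; first by case: (in_ultra_setVsetC P UF).
by apply: (@filter_not_empty _ F); apply: filterS (filterI FP FnP) => n [].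
Qed.

Lemma eval_product X (e : X -> product_algebra) t n :
  eval e t n = eval (fun x => e x n) t.
Proof.
by elim: t => //= f ts IH; congr (interp _); apply: funext.
Qed.

Lemma ultraproduct_eq X (e : X -> product_algebra) s t :
  eval (fun x => class_of almost_eq (e x) : ultraproduct) s =
  eval (fun x => class_of almost_eq (e x) : ultraproduct) t <->
  F [set n | eval (fun x => e x n) s = eval (fun x => e x n) t].
Proof.
have ch := class_hom almost_eq_congruence.
rewrite -!(hom_eval _ _ ch) (class_eqP almost_eq_congruence) /almost_eq.
by split; apply: filterS => n; rewrite /= !eval_product.
Qed.

(** Los's theorem, by induction on the formula. *)
Lemma ultraproduct_sat m (phi : formula S m) (e : 'I_m -> product_algebra) :
  sat phi (fun i => class_of almost_eq (e i) : ultraproduct) <->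
  F [set n | sat phi (fun i => e i n)].
Proof.
elim: phi e => {m} [m|m s t|m phi IHp psi IHq|m phi IH] e /=.
- by split=> // F0; apply: (@filter_not_empty _ F).
- exact: ultraproduct_eq.
- rewrite IHp IHq; split=> [pq|pq p]; last by apply: filterS2 pq p => n; apply.
  (* Maximality of [F]: if the premise fails in the ultraproduct, it fails at almost all [n]. *)
  have [/pq|/ultra_not] := EM (F [set n | sat phi (fun i => e i n)]).
    by apply: filterS => n hq hp.
  by apply: filterS => n np /np.
- have extE (a : product_algebra) : sat phi (extend (class_of almost_eq a : ultraproduct)
      (fun i => class_of almost_eq (e i))) <->
      F [set n | sat phi (extend (a n) (fun i => e i n))].
    rewrite -(comp_extend (class_of almost_eq : product_algebra -> ultraproduct)) IH.
    by split; apply: filterS => n;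
      rewrite /= (comp_extend (fun b : product_algebra => b n)).
  split=> [all|all c]; last first.
    rewrite -(class_repr (c : quotient almost_eq)); apply/extE.
    by apply: filterS all => n; apply.
  (* At each [n] pick a counterexample if there is one, and [x0 n] otherwise. Where the body holds
     of this choice, it holds of every element. *)
  have wit n : exists b : N n, sat phi (extend b (fun i => e i n)) ->
      forall b, sat phi (extend b (fun i => e i n)).
    have [h|/existsNP[b nb]] := EM (forall b, sat phi (extend b (fun i => e i n))).
      by exists (x0 n).
    by exists b => /nb.
  pose a n := sval (cid (wit n)).
  have /extE := all (class_of almost_eq a); apply: filterS => n.
  exact: svalP (cid (wit n)).
Qed.

End Ultraproduct.

(** * Diagrams and model completions *)

Lemma fun_ord0 (T : Type) (e e' : 'I_0 -> T) : e = e'.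
Proof. by apply: funext => -[]. Qed.

Lemma filter_all_in (T I : Type) (F : set_system T) (s : seq I) (P : I -> set T) :
  Filter F -> (forall i, List.In i s -> F (P i)) ->
  F [set t | forall i, List.In i s -> P i t].
Proof.
move=> FF; elim: s => [|i s IH] FP; first by apply: nearW => t i [].
have := FP i (or_introl erefl); apply: filterS2 (IH (fun k ks => FP k (or_intror ks))).
by move=> t Ps Pi k [<-|/Ps].
Qed.

Section Diagrams.
Variable S : signature.
Implicit Types M N : algebra S.

Lemma hom_holds M N (h : M -> N) (e : nat -> M) eps :
  homomorphism h -> holds e eps -> holds (fun v => h (e v)) eps.
Proof. by move=> hh; rewrite /holds -!(hom_eval _ _ hh) => ->. Qed.

Lemma embedding_holds M N (h : M -> N) (e : nat -> M) eps :
  embedding h -> holds (fun v => h (e v)) eps -> holds e eps.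
Proof. by case=> hh hi; rewrite /holds -!(hom_eval _ _ hh) => /hi. Qed.

Lemma embedding_comp M N (P : algebra S) (h : M -> N) (k : N -> P) :
  embedding h -> embedding k -> embedding (fun m => k (h m)).
Proof.
move=> [hh hi] [kh ki]; split; first exact: hom_comp hh kh.
exact: inj_comp ki hi.
Qed.

Lemma eval_lift C X M (c : C -> M) (e : X -> M) t :
  eval (A := expansion c) e (lift_term C t) = eval e t.
Proof.
elim: t => //= f ts IH; congr (interp _).
by apply: funext => i; rewrite IH.
Qed.

Lemma sat_lift C M (c : C -> M) n (phi : formula S n) (e : 'I_n -> M) :
  sat (A := expansion c) (lift_formula C phi) e <-> sat phi e.
Proof.
elim: phi e => {n} //= [n s t|n phi IHp psi IHq|n phi IH] e.
- by rewrite !eval_lift.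
- by rewrite IHp IHq.
- by split=> all a; apply/IH.
Qed.

Lemma models_lift C M (c : C -> M) (T : theory S) :
  models M T -> models (expansion c) (lift_theory (C := C) T).
Proof.
move=> MT _ [psi Tpsi ->]; have := MT psi Tpsi.
rewrite /satisfies => /(sat_lift c).
by congr sat; apply: fun_ord0.
Qed.

Lemma expansion_hom M N (h : M -> N) : homomorphism h ->
  @homomorphism _ (expansion (fun m : M => m)) (expansion h) h.
Proof. by move=> hh [f|m] a //=; exact: hh. Qed.

(** Homomorphisms preserve equations with constants from [M], and injectivity reflects them; the
    induction carries both directions because [FImp] reverses them. *)
Lemma embedding_sat M N (h : M -> N) n
    (phi : formula (add_constants S M) n) (e : 'I_n -> M) :
  embedding h -> quantifier_free phi ->
  sat (A := expansion (fun m : M => m)) phi e <->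
  sat (A := expansion h) phi (fun i => h (e i)).
Proof.
move=> [hh hi]; have eh := expansion_hom hh.
elim: phi e => {n} //= [n s t|n phi IHp psi IHq] e.
  move=> _; rewrite -!(@hom_eval _ _ (expansion id) (expansion h) h e _ eh).
  by split=> [->|/hi].
by case=> /IHp-> /IHq->.
Qed.

Lemma embedding_diagram M N (h : M -> N) :
  embedding h -> models (expansion h) (@qf_diagram S M).
Proof.
move=> emb phi [qf]; rewrite /satisfies => /(embedding_sat _ emb qf).
by congr sat; apply: fun_ord0.
Qed.

(** Bridges equations over arbitrary variables and formulas over ['I_n]; [rho] may also send a
    variable to a constant. *)
Definition instance X n (rho : X -> term S 'I_n)
    (eps : term S X * term S X) : formula S n :=
  FEq (subst rho eps.1) (subst rho eps.2).

Definition premises X n (rho : X -> term S 'I_n)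
    (Sigma : seq (term S X * term S X)) (phi : formula S n) : formula S n :=
  foldr (fun sigma => FImp (instance rho sigma)) phi Sigma.

Lemma sat_instance n M (rho : nat -> term S 'I_n) (e : 'I_n -> M) eps :
  sat (instance rho eps) e <-> holds (fun v => eval e (rho v)) eps.
Proof. by rewrite /= !eval_subst. Qed.

Lemma sat_premises n M (rho : nat -> term S 'I_n) (e : 'I_n -> M) Sigma phi :
  sat (premises rho Sigma phi) e <->
  ((forall sigma, List.In sigma Sigma -> holds (fun v => eval e (rho v)) sigma) ->
   sat phi e).
Proof.
elim: Sigma => [|s Sigma IH]; first by split=> // H; exact: H.
have -> : sat (premises rho (s :: Sigma) phi) e =
  (sat (instance rho s) e -> sat (premises rho Sigma phi) e) by [].
rewrite sat_instance IH; split=> [H HS|H Hs HS].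
  by apply: H => [|sigma Ss]; apply: HS; [left|right].
by apply: H => sigma [<-|/HS].
Qed.

End Diagrams.

(** * Failure of model completion *)

Section NoModelCompletion.
Variable Tstar : theory dh_signature.
Hypothesis Tstar_completion : model_completion (theory_of double_heyting) Tstar.

Let S := dh_signature.

Definition var3 : nat -> term S 'I_3 :=
  assign (Var ord0) (Var (lift ord0 ord0)) (Var (lift ord0 (lift ord0 ord0))).

(** Being in the theory of the class, this sentence holds in every model of [Tstar], without showing
    such a model to be a double-Heyting algebra. *)
Definition core_sentence k : sentence S :=
  FAll (FAll (FAll (premises var3 fixpoint_equations (instance var3 (core_equation k))))).

Lemma comp_assign (T U : Type) (f : T -> U) y x z :
  (fun v => f (assign y x z v)) = assign (f y) (f x) (f z).
Proof. by apply: funext => -[|[]]. Qed.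

Lemma satisfies_core_sentence (A : algebra S) k :
  satisfies A (core_sentence k) <-> forall y x z : A,
    (forall sigma, List.In sigma fixpoint_equations -> holds (assign y x z) sigma) ->
    holds (assign y x z) (core_equation k).
Proof.
have vE (y x z : A) : (fun v => eval (extend y (extend x (extend z (no_vars A)))) (var3 v)) =
    assign y x z.
  by rewrite /var3 (comp_assign (eval _)) /= !extendS !extend0.
have -> : satisfies A (core_sentence k) = forall z x y : A,
    sat (premises var3 fixpoint_equations (instance var3 (core_equation k)))
      (extend y (extend x (extend z (no_vars A)))) by [].
split=> [H y x z|H z x y]; last by rewrite sat_premises sat_instance vE; exact: H.
by have := H z x y; rewrite sat_premises sat_instance vE.
Qed.

Lemma core_sentence_theory k : theory_of double_heyting (core_sentence k).
Proof.
by move=> A HA; apply/satisfies_core_sentence => y x z; exact: fixpoint_core.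
Qed.

Lemma completion_extension (A : algebra S) : double_heyting A ->
  exists N, models N Tstar /\ exists h : A -> N, embedding h.
Proof. by move=> HA; case: Tstar_completion => _ ext _; apply: ext => phi; apply. Qed.

(** Such a [y] would give z <= t^k x in [N] for every [k], and the embedding reflects this to the
    linked fences. *)
Lemma linked_no_fixpoint n (N : algebra S) (h : fence_algebra (pred1 n) -> N) y :
  models N Tstar -> embedding h ->
  ~ forall sigma, List.In sigma fixpoint_equations ->
      holds (assign y (h (off_left_end _)) (h (right_end _))) sigma.
Proof.
move=> NT emb fixy; have [k] := core_iterate_linked n; apply.
have /satisfies_core_sentence/(_ _ _ _ fixy) : satisfies N (core_sentence k).
  by apply: NT; case: Tstar_completion => TT _ _; apply: TT; exact: core_sentence_theory.
move=> /holds_core_equation hk.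
(* The first entry is an arbitrary value for the variable 0, which [core_equation k] does not
   contain. *)
suff /holds_core_equation : holds (assign (off_left_end _) (off_left_end _)
  (right_end (pred1 n))) (core_equation k) by [].
apply: (embedding_holds emb); rewrite (comp_assign h); exact/holds_core_equation.
Qed.

Let G (U : fence_algebra pred0) : Prop := U = off_left_end _ \/ U = right_end _.
Let M : algebra S := generated_subalgebra G.

Lemma generated_a : generated G (off_left_end _). Proof. by move=> P _; apply; left. Qed.
Lemma generated_c : generated G (right_end _). Proof. by move=> P _; apply; right. Qed.

Let aM : M := exist _ _ generated_a.
Let cM : M := exist _ _ generated_c.

(** Thus [cut n] eventually respects any given operation on elements of [M] and separates any two of
    them. *)
Lemma tame_generated (m : M) : tame (sval m).
Proof.
apply: (svalP m); first exact: tame_subuniverse.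
by move=> U [->|->]; [exact: tame_a|exact: tame_c].
Qed.

Lemma sval_embedding : embedding (sval : M -> fence_algebra pred0).
Proof.
split=> // m m'; exact: eq_sig_hprop (fun _ => @Prop_irrelevance _) _ _.
Qed.

Definition var1 : nat -> term (add_constants S M) 'I_1 :=
  assign (Var ord0) (@App (add_constants S M) _ (inr aM) (no_vars _))
    (@App (add_constants S M) _ (inr cM) (no_vars _)).

Definition no_fixpoint_sentence : sentence (add_constants S M) :=
  FAll (premises var1
    [seq (lift_term M s.1, lift_term M s.2) | s <- fixpoint_equations] FFalse).

Lemma satisfies_no_fixpoint (N : algebra S) (h : M -> N) :
  satisfies (expansion h) no_fixpoint_sentence <-> forall y,
    ~ forall sigma, List.In sigma fixpoint_equations -> holds (assign y (h aM) (h cM)) sigma.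
Proof.
have vE y : (fun v => eval (A := expansion h) (extend y (no_vars N)) (var1 v)) =
    assign y (h aM) (h cM).
  by rewrite /var1 (comp_assign (eval (A := expansion h) _)) /= extend0.
have hE y : (forall sigma, List.In sigma
      [seq (lift_term M s.1, lift_term M s.2) | s <- fixpoint_equations] ->
      holds (A := expansion h) (assign y (h aM) (h cM)) sigma) <->
    forall sigma, List.In sigma fixpoint_equations -> holds (assign y (h aM) (h cM)) sigma.
  split=> H.
    move=> s Ss; rewrite /holds -!(eval_lift h).
    apply: (H (lift_term M s.1, lift_term M s.2)).
    by apply/In_map; exists s.
  by move=> _ /In_map[s [<- /H]]; rewrite /holds -!(eval_lift h).
have -> : satisfies (expansion h) no_fixpoint_sentence = forall y : N,
    sat (A := expansion h) (premises var1 [seq (lift_term M s.1, lift_term M s.2)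
      | s <- fixpoint_equations] FFalse) (extend y (no_vars N)) by [].
by split=> H y; have := H y; rewrite sat_premises vE hE.
Qed.

(** [Tstar] with the diagram of [M] would decide whether some y lies between the generators. Yet
    [B], extending the unlinked fences, has one, and the ultraproduct [V] of extensions of linked
    fences has none. *)
Lemma no_model_completion : False.
Proof.
have [B [BT [i iemb]]] := completion_extension (fence_double_heyting pred0).
have ext n := completion_extension (fence_double_heyting (pred1 n)).
pose N n := sval (cid (ext n)).
have NT n : models (N n) Tstar := (svalP (cid (ext n))).1.
have emb n : exists h : fence_algebra (pred1 n) -> N n, embedding h := (svalP (cid (ext n))).2.
pose j n := sval (cid (emb n)); have jemb n : embedding (j n) := svalP (cid (emb n)).
(* [F] contains all cofinite sets, so what holds for all large [n] holds almost everywhere. *)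
have [F [UF oF]] := ultraFilterLemma eventually_filter.
pose V := ultraproduct N F.
have VT : models V Tstar.
  move=> phi Tphi.
  rewrite /satisfies (fun_ord0 (no_vars V) (fun k =>
    class_of (@almost_eq _ N F) (no_vars (product_algebra N) k) : V)).
  apply/(ultraproduct_sat UF (fun n => j n (off_left_end _))); apply: nearW => n /=.
  by rewrite (fun_ord0 (fun _ => _) (no_vars (N n))); exact: NT.
(* [cut n] is known to respect a given operation for large [n]; modulo [F] this makes [h] a
   homomorphism. *)
pose h0 (m : M) : product_algebra N := fun n => j n (cut n (sval m)).
pose h (m : M) : V := class_of (@almost_eq _ N F) (h0 m).
have hemb : embedding h.
  have cP := almost_eq_congruence N UF.
  split=> [f m|m m' /(class_eqP cP) hmm'].
    rewrite -(class_hom cP (fun i => h0 (m i))); apply/(class_eqP cP).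
    apply: oF; apply: filterS (cut_interp (fun i => tame_generated (m i))) => n /= mn.
    by rewrite /h0 mn (jemb n).1.
  apply: contrapT => mm'.
  have smm' : sval m <> sval m' by move=> /sval_embedding.2.
  have := oF _ (cut_inj (tame_generated m) (tame_generated m') smm').
  move=> /(filterI hmm') /filter_ex[n [/(jemb n).2 ? []]]//.
have MD : models M (theory_of double_heyting).
  by move=> phi; apply; exact: embedding_double_heyting sval_embedding (fence_double_heyting _).
case: Tstar_completion => _ _ /(_ _ MD) /(_ no_fixpoint_sentence)[] ent.
- have : satisfies (expansion (fun m : M => i (sval m))) no_fixpoint_sentence.
    apply: ent => phi [Tphi|Dphi].
      exact: (models_lift _ BT).
    exact: (embedding_diagram (embedding_comp sval_embedding iemb)).
  move=> /satisfies_no_fixpoint/(_ (i right_half)); apply => sigma Ss.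
  rewrite -(comp_assign i); apply: (hom_holds iemb.1).
  exact: (holds_fixpoint_equations _).2 unlinked_fixpoint _ Ss.
- have : satisfies (expansion h) (FNot no_fixpoint_sentence).
    apply: ent => phi [Tphi|Dphi]; first exact: (models_lift _ VT).
    exact: (embedding_diagram hemb).
  apply; apply/satisfies_no_fixpoint => y.
  rewrite -(class_repr (y : quotient (@almost_eq _ N F))); move: (repr _) => b fixb.
  pose e0 n := assign (b n) (j n (cut n (off_left_end _))) (j n (cut n (right_end _))).
  (* The equations are finitely many, so they hold simultaneously at almost all [n]; one such [n] is
     also large enough for [cut n] to keep x and z. *)
  have : F [set n | forall sigma, List.In sigma fixpoint_equations -> holds (e0 n) sigma].
    apply: filter_all_in => sigma Ss; have := fixb sigma Ss.
    rewrite (_ : assign _ _ _ = fun v => class_of (@almost_eq _ N F)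
      (assign b (h0 aM) (h0 cM) v)); last by rewrite comp_assign.
    move=> /(ultraproduct_eq UF); apply: filterS => n.
    by rewrite /= (comp_assign (fun x : product_algebra N => x n)).
  move=> Fb; have nac : \oo [set n |
      cut n (off_left_end _) = off_left_end _ /\ cut n (right_end _) = right_end _].
    exact: filterI cut_a cut_c.
  have [n [nb [na nc]]] := filter_ex (filterI Fb (oF _ nac)).
  by apply: (linked_no_fixpoint (NT n) (jemb n) (y := b n)); move: nb; rewrite /e0 /= na nc.
Qed.

End NoModelCompletion.

Theorem corollary5p7 :
  ~ coherent double_heyting /\
  ~ right_uniform_deductive_interpolation double_heyting /\
  ~ (exists Tstar : theory dh_signature,
       model_completion (theory_of double_heyting) Tstar).
Proof.
split; first exact: not_coherent.
split; first exact: not_right_uniform_interpolation.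
by move=> [Tstar]; exact: no_model_completion.
Qed.
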